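(* Let $M_0$ be an r-framed, 2-ruled, coassociative cone in $\mathbb{R}^7$ defined by $\phi_1,\phi_2:\Sigma\to\mathcal{S}^6$ in the flat gauge, where $\Sigma$ is a Riemann surface. Let $w$ be a holomorphic vector field on $\Sigma$ and define $\psi:\Sigma\to\mathbb{R}^7$ by $\psi=\mathcal{L}_w\phi_1+\mathcal{L}_{iw}\phi_2$, where $\mathcal{L}_w,\mathcal{L}_{iw}$ denote the Lie derivatives with respect to $w,iw$. Let $$M=\{r_1\phi_1(\sigma)+r_2\phi_2(\sigma)+\psi(\sigma):r_1,r_2\in\mathbb{R},\ \sigma\in\Sigma\}.$$ Then $M$ is an r-framed 2-ruled coassociative 4-fold in $\mathbb{R}^7$.
   Context: Write $d\mathbf{x}_{ij\ldots k}=dx_i\wedge dx_j\wedge\cdots\wedge dx_k$. On $\mathbb{R}^7$ let $$\varphi=d\mathbf{x}_{123}+d\mathbf{x}_{145}+d\mathbf{x}_{167}+d\mathbf{x}_{246}-d\mathbf{x}_{257}-d\mathbf{x}_{347}-d\mathbf{x}_{356},$$ $$\ast\varphi=d\mathbf{x}_{4567}+d\mathbf{x}_{2367}+d\mathbf{x}_{2345}+d\mathbf{x}_{1357}-d\mathbf{x}_{1346}-d\mathbf{x}_{1256}-d\mathbf{x}_{1247}.$$ A 4-dimensional submanifold of $\mathbb{R}^7$ is coassociative if, for a suitable orientation, $\ast\varphi$ restricts to the Riemannian volume form on each of its tangent spaces. The triple cross product on $\mathbb{R}^7$ is defined by $g(x\times y\times z,w)=\ast\varphi(x,y,z,w)$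 for all $w$, with $g$ the Euclidean metric. A 2-ruled 4-fold is an (immersed) 4-dimensional submanifold with a smooth map to a 2-manifold $\Sigma$ whose fibres are affine 2-planes; it is r-framed if an oriented orthonormal basis $(\phi_1(\sigma),\phi_2(\sigma))$ of each fibre direction is chosen smoothly. It is then the image of $\iota_M(r_1,r_2,\sigma)=r_1\phi_1(\sigma)+r_2\phi_2(\sigma)+\psi(\sigma)$ on $\mathbb{R}^2\times\Sigma$; singularities (points where $\iota_M$ is not an immersion) are allowed, and ''coassociative'' refers to the points where it is an immersion. The r-framed 2-ruled cone defined by the orthogonal smooth maps $\phi_1,\phi_2$ is $M_0=\{r_1\phi_1(\sigma)+r_2\phi_2(\sigma):\sigma\in\Sigma,\ r_1,r_2\in\mathbb{R}\}$ (nonsingular except at $0$). The complex structure of $\Sigma$ is the one adapted to $M_0$: together with the flat gauge condition this means that for every local holomorphic coordinate $s+it$ on $\Sigma$, $$\frac{\partial\phi_j}{\partial t}=\phi_1\times\phi_2\times\frac{\partial\phi_j}{\partial s},\qquad \frac{\partial\phi_j}{\partial s}=-\phi_1\times\phi_2\times\frac{\partial\phi_j}{\partial t}\qquad (j=1,2).$$ A holomorphic vector field $w$ is regarded as a real vector field: locally $w=u\,\partial_s+v\,\partial_t$ with $u+iv$ holomorphic in $s+it$, and $iw=-v\,\partial_s+u\,\partial_t$. *)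

(* Defs.v *)
From HB Require Import structures.
From mathcomp Require Import all_boot all_order all_algebra.
From mathcomp Require Import all_classical all_reals all_analysis.
From mathcomp Require Import complex.

Set Implicit Arguments.
Unset Strict Implicit.
Unset Printing Implicit Defensive.

Import Order.TTheory GRing.Theory Num.Theory.
Import numFieldNormedType.Exports.

Local Open Scope classical_set_scope.
Local Open Scope complex_scope.
Local Open Scope ring_scope.

(* R[i]^o is C as a normed space over itself, so [derivable f z 1] is complex
   differentiability and ['D_1 f z] is the complex derivative. *)
Definition holomorphic_on (R : realType) (U : set R[i]^o)
    (f : R[i]^o -> R[i]^o) : Prop :=
  forall z, U z -> derivable f z 1.

Record chart (R : realType) (S : topologicalType) := Chart {
  cdom : set S ;
  ccod : set R[i]^o ;
  cmap : S -> R[i]^o ;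
  cinv : R[i]^o -> S ;
  cdom_open : open cdom ;
  ccod_open : open ccod ;
  cmap_cod : forall x, cdom x -> ccod (cmap x) ;
  cinv_dom : forall z, ccod z -> cdom (cinv z) ;
  cmapK : forall x, cdom x -> cinv (cmap x) = x ;
  cinvK : forall z, ccod z -> cmap (cinv z) = z ;
  cmap_continuous : forall x, cdom x -> {for x, continuous cmap} ;
  cinv_continuous : forall z, ccod z -> {for z, continuous cinv}
}.

Definition transition (R : realType) (S : topologicalType) (c c' : chart R S) :
    R[i]^o -> R[i]^o :=
  fun z => cmap c' (cinv c z).

Definition overlap (R : realType) (S : topologicalType) (c c' : chart R S) :
    set R[i]^o :=
  [set z | ccod c z /\ cdom c' (cinv c z)].

Definition compatible (R : realType) (S : topologicalType) (c c' : chart R S) :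
    Prop :=
  holomorphic_on (overlap c c') (transition c c') /\
  holomorphic_on (overlap c' c) (transition c' c).

(* By maximality, the members of [atlas] are all the local holomorphic
   coordinates s + it. *)
Record riemann_surface (R : realType) := RiemannSurface {
  rs_space :> topologicalType ;
  atlas : set (chart R rs_space) ;
  rs_hausdorff : hausdorff_space rs_space ;
  rs_second_countable : @second_countable rs_space ;
  atlas_cover : forall x : rs_space, exists2 c, atlas c & cdom c x ;
  atlas_compatible : forall c c', atlas c -> atlas c' -> compatible c c' ;
  atlas_maximal : forall c, (forall c', atlas c' -> compatible c c') -> atlas c
}.

(* C^k on an open set U of the (s, t)-plane. *)
Fixpoint Ck (R : realType) (V : normedModType R) (k : nat)
    (U : set (R * R)%type) (f : R * R -> V) : Prop :=
  if k is k'.+1 then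
    [/\ forall p, U p -> differentiable f p,
        Ck k' U (fun p => 'D_((1, 0) : R * R) f p)
      & Ck k' U (fun p => 'D_((0, 1) : R * R) f p)]
  else forall p, U p -> {for p, continuous f}.

Definition cplx (R : realType) (p : R * R) : R[i]^o := p.1 +i* p.2.

Section Surface.
Variables (R : realType) (S : riemann_surface R).

Definition smooth_in (V : normedModType R) (c : chart R S) (f : S -> V) : Prop :=
  forall k, Ck k [set p | ccod c (cplx p)] (fun p => f (cinv c (cplx p))).

Definition smooth (V : normedModType R) (f : S -> V) : Prop :=
  forall c, atlas c -> smooth_in c f.

Definition dchart (V : normedModType R) (e : R * R) (c : chart R S)
    (f : S -> V) (x : S) : V :=
  'D_e (fun p => f (cinv c (cplx p))) (complex.Re (cmap c x), complex.Im (cmap c x)).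

Definition ds (V : normedModType R) := @dchart V (1, 0).
Definition dt (V : normedModType R) := @dchart V (0, 1).

(* [w c x] is the complex number u + iv such that the real vector field is
   u d/ds + v d/dt at x in the coordinate c = s + it; only its values for
   c in the atlas and x in the domain of c are meaningful. *)
Definition vfield := chart R S -> S -> R[i]^o.

(* The real Jacobian of a holomorphic change of coordinates is multiplication
   by its complex derivative. *)
Definition vfield_law (w : vfield) : Prop :=
  forall c c' x, atlas c -> atlas c' -> cdom c x -> cdom c' x ->
    w c' x = 'D_1 (transition c c') (cmap c x) * w c x.

Definition vfield_smooth (w : vfield) : Prop :=
  forall c, atlas c ->
    smooth_in c (fun x => complex.Re (w c x) : R) /\
    smooth_in c (fun x => complex.Im (w c x) : R).

Definition holomorphic_vfield (w : vfield) : Prop :=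
  [/\ vfield_law w, vfield_smooth w
    & forall c, atlas c -> holomorphic_on (ccod c) (fun z => w c (cinv c z))].

Definition ivfield (w : vfield) : vfield := fun c x => (0 +i* 1) * w c x.

Definition chart_at (x : S) : chart R S := s2val (cid2 (atlas_cover x)).

(* For a vector field obeying [vfield_law] the choice of chart is immaterial. *)
Definition lie (V : normedModType R) (w : vfield) (f : S -> V) (x : S) : V :=
  let c := chart_at x in
  complex.Re (w c x) *: ds c f x + complex.Im (w c x) *: dt c f x.

End Surface.

Definition dot (R : realType) (x y : 'rV[R]_7) : R := \sum_i x 0 i * y 0 i.

(* [dx i j k l A] is dx_i /\ dx_j /\ dx_k /\ dx_l on the four rows of A, with
   coordinates numbered from 1. *)
Definition dx (R : realType) (i j k l : nat) (A : 'M[R]_(4, 7)) : R :=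
  \det (\matrix_(a < 4, b < 4) A a (inord (nth 0%N [:: i; j; k; l] b).-1)).

Definition starphi (R : realType) (A : 'M[R]_(4, 7)) : R :=
  dx 4 5 6 7 A + dx 2 3 6 7 A + dx 2 3 4 5 A + dx 1 3 5 7 A
  - dx 1 3 4 6 A - dx 1 2 5 6 A - dx 1 2 4 7 A.

Definition rows4 (R : realType) (x y z w : 'rV[R]_7) : 'M[R]_(4, 7) :=
  \matrix_(a < 4) nth 0 [:: x; y; z; w] a.

Definition triple_cross (R : realType) (x y z : 'rV[R]_7) : 'rV[R]_7 :=
  \row_j starphi (rows4 x y z (delta_mx 0 j)).

Lemma dx_rows4 (R : realType) i j k l (x y z w : 'rV[R]_7) :
  dx i j k l (rows4 x y z w) =
  \sum_m dx i j k l (rows4 x y z (delta_mx 0 m)) * w 0 m.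
Proof.
pose col (b : 'I_4) : 'I_7 := inord (nth 0%N [:: i; j; k; l] b).-1.
pose B v : 'M[R]_4 := \matrix_(a, b) rows4 x y z v a (col b).
have BE v : dx i j k l (rows4 x y z v) =
    \sum_b v 0 (col b) * cofactor (B 0) ord_max b.
  rewrite /dx (expand_det_row _ ord_max); apply: eq_bigr => b _.
  rewrite !mxE /=; congr (_ * (_ * \det _)).
  by apply/matrixP => a b'; rewrite !mxE; case: a => [[|[|[|]]]] //=.
rewrite BE; under [RHS]eq_bigr do rewrite BE mulr_suml.
rewrite exchange_big /=; apply: eq_bigr => b _.
rewrite (bigD1 (col b)) //= big1 ?addr0 => [|m mb]; rewrite mxE eqxx /=.
  by rewrite eqxx mul1r mulrC.
by rewrite eq_sym (negbTE mb) !mul0r.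
Qed.

Lemma triple_crossP (R : realType) (x y z w : 'rV[R]_7) :
  dot (triple_cross x y z) w = starphi (rows4 x y z w).
Proof.
rewrite /dot /starphi !(@dx_rows4 _ _ _ _ _ _ _ _ w) -!sumrN -!big_split /=.
by apply: eq_bigr => m _; rewrite mxE /starphi !mulrDl !mulNr.
Qed.

Section Ruled.
Variables (R : realType) (S : riemann_surface R).

Let point := ((R * R) * S)%type.

(* Rows: the images of d/dr1, d/dr2, d/ds, d/dt under the differential of F. *)
Definition frame (c : chart R S) (F : point -> 'rV[R]_7) (q : point) :
    'M[R]_(4, 7) :=
  rows4 ('D_((1, 0) : R * R) (fun r => F (r, q.2)) q.1)
        ('D_((0, 1) : R * R) (fun r => F (r, q.2)) q.1)
        (ds c (fun x => F (q.1, x)) q.2)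
        (dt c (fun x => F (q.1, x)) q.2).

Definition immersion_at (F : point -> 'rV[R]_7) (q : point) : Prop :=
  forall c, atlas c -> cdom c q.2 -> \rank (frame c F q) = 4%N.

(* An orientation of the immersed locus is encoded by its locally constant
   sign [o] relative to the frames (d/dr1, d/dr2, d/ds, d/dt); these frames
   all define the same orientation of R^2 x S, as holomorphic transition maps
   preserve orientation.  On tangent vectors C *m E, where E is a basis of the
   tangent space, the volume form is +/- det C * sqrt (det g) with
   g = E *m E^T the matrix of the induced metric. *)
Definition coassociative (F : point -> 'rV[R]_7) : Prop :=
  exists o : point -> bool,
    (forall q, immersion_at F q ->
       \forall q' \near q, immersion_at F q' -> o q' = o q) /\
    (forall q c, immersion_at F q -> atlas c -> cdom c q.2 ->
       forall C : 'M[R]_4,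
         let E := frame c F q in
         starphi (C *m E) =
         (-1) ^+ o q * (\det C * Num.sqrt (\det (E *m E^T)))).

Definition iota2 (phi1 phi2 psi : S -> 'rV[R]_7) (q : point) : 'rV[R]_7 :=
  q.1.1 *: phi1 q.2 + q.1.2 *: phi2 q.2 + psi q.2.

Definition orthonormal (phi1 phi2 : S -> 'rV[R]_7) : Prop :=
  forall x, [/\ dot (phi1 x) (phi1 x) = 1, dot (phi2 x) (phi2 x) = 1
              & dot (phi1 x) (phi2 x) = 0].

(* Singularities are allowed, but the immersed locus must be dense for M to be
   a 4-fold. *)
Definition rframed_2ruled (M : set 'rV[R]_7) (phi1 phi2 psi : S -> 'rV[R]_7) :
    Prop :=
  [/\ [/\ smooth phi1, smooth phi2 & smooth psi],
      orthonormal phi1 phi2,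
      M = range (iota2 phi1 phi2 psi)
    & dense [set q | immersion_at (iota2 phi1 phi2 psi) q]].

Definition rframed_2ruled_coassociative (M : set 'rV[R]_7)
    (phi1 phi2 psi : S -> 'rV[R]_7) : Prop :=
  rframed_2ruled M phi1 phi2 psi /\ coassociative (iota2 phi1 phi2 psi).

Definition rframed_2ruled_coassociative_cone (M0 : set 'rV[R]_7)
    (phi1 phi2 : S -> 'rV[R]_7) : Prop :=
  rframed_2ruled_coassociative M0 phi1 phi2 (fun=> 0) /\
  forall q : point, q.1 <> (0, 0) ->
    immersion_at (iota2 phi1 phi2 (fun=> 0)) q.

Definition adapted_flat_gauge (phi1 phi2 : S -> 'rV[R]_7) : Prop :=
  forall c x, atlas c -> cdom c x ->
  forall phi, phi = phi1 \/ phi = phi2 ->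
    dt c phi x = triple_cross (phi1 x) (phi2 x) (ds c phi x) /\
    ds c phi x = - triple_cross (phi1 x) (phi2 x) (dt c phi x).

End Ruled.

(* Main.v *)
From HB Require Import structures.
Require Import Defs.
From mathcomp Require Import all_boot all_order all_algebra.
From mathcomp Require Import all_classical all_reals all_analysis.
From mathcomp Require Import complex ring lra.

Set Implicit Arguments.
Unset Strict Implicit.
Unset Printing Implicit Defensive.

Import Order.TTheory GRing.Theory Num.Theory.
Import numFieldNormedType.Exports.

Local Open Scope classical_set_scope.
Local Open Scope complex_scope.
Local Open Scope ring_scope.

(** Write [p, q] for the values of [phi1, phi2] and [J] for [p x q x -].  If
    [Y = J X] and [X = - J Y] modulo [span (p, q)], then [*phi (p, q, X, Y)] is
    [|J X|^2] and the Gram determinant of [(p, q, X, Y)] is [|J X|^4], so the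
    frame is calibrated.  By the gauge equations, for the frames of [M] this is a
    condition on [psi] alone: [psi_t = J psi_s] and [psi_s = - J psi_t] modulo
    [span (p, q)].  In [psi_t - J psi_s] the derivatives of [w] cancel by the
    Cauchy-Riemann equations.  Differentiating the gauge equations and using
    the symmetry of second derivatives turns the second derivatives of [phi1] and
    [phi2] into triple products, which lie in [span (p, q)] by identities for the
    cross product of R^7 on the complement of the associative plane
    [(p, q, p x q)].  Finally [J X] is affine in [r1] with slope [J (phi1_s)],
    nonzero because the cone is immersed off its vertex; hence the immersed
    locus is dense in every fibre. *)

(** * The cross products of R^7 *)

Section G2Algebra.
Variable R : realType.
Implicit Types x y z : 'rV[R]_7.

Lemma sum7E (V : nmodType) (F : 'I_7 -> V) :
  \sum_i F i = F (inord 0) + F (inord 1) + F (inord 2) + F (inord 3)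
    + F (inord 4) + F (inord 5) + F (inord 6).
Proof.
rewrite !big_ord_recr big_ord0 /= add0r.
by do ![congr (_ + _)]; congr (F _); apply: val_inj; rewrite /= inordK.
Qed.

(** Laplace expansion along the first two rows. Complementary 2 by 2 minors match the products of
    [minor] in [dx_rows4E], and turn statements about [starphi] into polynomial identities. *)
Lemma det4E (A : 'M[R]_4) : let a i j := A (inord i) (inord j) in
  \det A =
   (a 0 0 * a 1 1 - a 0 1 * a 1 0) * (a 2 2 * a 3 3 - a 2 3 * a 3 2)
 - (a 0 0 * a 1 2 - a 0 2 * a 1 0) * (a 2 1 * a 3 3 - a 2 3 * a 3 1)
 + (a 0 0 * a 1 3 - a 0 3 * a 1 0) * (a 2 1 * a 3 2 - a 2 2 * a 3 1)
 + (a 0 1 * a 1 2 - a 0 2 * a 1 1) * (a 2 0 * a 3 3 - a 2 3 * a 3 0)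
 - (a 0 1 * a 1 3 - a 0 3 * a 1 1) * (a 2 0 * a 3 2 - a 2 2 * a 3 0)
 + (a 0 2 * a 1 3 - a 0 3 * a 1 2) * (a 2 0 * a 3 1 - a 2 1 * a 3 0).
Proof.
move=> a.
pose b i j := A (inord i) (inord j).
have bE (i j : 'I_4) : A i j = b i j by rewrite /b !inord_val.
do 3! (rewrite !(expand_det_row _ ord0) !big_ord_recr !big_ord0 /=
  /cofactor).
rewrite !det_mx11 !mxE !bE /= /bump /=.
rewrite -[a]/b.
rewrite !addn0 !addn1 /= !add0r.
ring.
Qed.

(* Coordinates are numbered from 1, as in [dx]. *)
Definition minor x y (i j : nat) : R :=
  x 0 (inord i.-1) * y 0 (inord j.-1) - x 0 (inord j.-1) * y 0 (inord i.-1).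

(* Determined by [dot (cross x y) z = phi (x, y, z)]: the k-th entry collects
   the terms of phi that contain dx_k. *)
Definition cross x y : 'rV[R]_7 :=
  let m := minor x y in
  \row_j nth 0 [:: m 2 3 + m 4 5 + m 6 7; m 3 1 + m 4 6 - m 5 7;
    m 1 2 - m 4 7 - m 5 6; m 5 1 + m 6 2 - m 7 3; m 1 4 - m 7 2 - m 6 3;
    m 7 1 + m 2 4 - m 3 5; m 1 6 - m 2 5 - m 3 4] j.

Lemma rowDE x y i j : (x + y) i j = x i j + y i j. Proof. exact: mxE. Qed.
Lemma rowNE x i j : (- x) i j = - x i j. Proof. exact: mxE. Qed.
Lemma rowZE (k : R) x i j : (k *: x) i j = k * x i j. Proof. exact: mxE. Qed.
Lemma row0E i j : (0 : 'rV[R]_7) i j = 0. Proof. exact: mxE. Qed.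
Definition row_linE := (rowDE, rowNE, rowZE, row0E).

Lemma row7P x y :
  (forall k, (k < 7)%N -> x 0 (inord k) = y 0 (inord k)) -> x = y.
Proof.
by move=> xy; apply/rowP => j; have := xy j (ltn_ord j); rewrite inord_val.
Qed.

Lemma dotC x y : dot x y = dot y x.
Proof. by apply: eq_bigr => i _; rewrite mulrC. Qed.
Lemma dotDl x y z : dot (x + y) z = dot x z + dot y z.
Proof. by rewrite -big_split; apply: eq_bigr => i _; rewrite !mxE mulrDl. Qed.
Lemma dotZl k x y : dot (k *: x) y = k * dot x y.
Proof. by rewrite mulr_sumr; apply: eq_bigr => i _; rewrite !mxE mulrA. Qed.
Lemma dotDr x y z : dot z (x + y) = dot z x + dot z y.
Proof. by rewrite !(dotC z) dotDl. Qed.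
Lemma dotZr k x y : dot x (k *: y) = k * dot x y.
Proof. by rewrite !(dotC x) dotZl. Qed.
Lemma dotNl x y : dot (- x) y = - dot x y.
Proof. by rewrite -scaleN1r dotZl mulN1r. Qed.
Lemma dotNr x y : dot x (- y) = - dot x y.
Proof. by rewrite !(dotC x) dotNl. Qed.
Lemma dot0l x : dot 0 x = 0.
Proof. by rewrite -(scale0r (0 : 'rV[R]_7)) dotZl mul0r. Qed.
Definition dot_linE := (dotDl, dotDr, dotZl, dotZr, dotNl, dotNr).

Lemma dot_eq0 x : dot x x = 0 -> x = 0.
Proof.
move=> /eqP; rewrite psumr_eq0 => [/allP x0|i _]; last by rewrite -expr2 sqr_ge0.
apply/rowP => i; rewrite mxE; apply/eqP.
by have := x0 i (mem_index_enum i); rewrite /= mulf_eq0 orbb.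
Qed.

Lemma dotE x y : dot x y =
  x 0 (inord 0) * y 0 (inord 0) + x 0 (inord 1) * y 0 (inord 1) +
  x 0 (inord 2) * y 0 (inord 2) + x 0 (inord 3) * y 0 (inord 3) +
  x 0 (inord 4) * y 0 (inord 4) + x 0 (inord 5) * y 0 (inord 5) +
  x 0 (inord 6) * y 0 (inord 6).
Proof. exact: sum7E. Qed.

Lemma crossE x y k : (k < 7)%N -> let m := minor x y in
  cross x y 0 (inord k) =
  nth 0 [:: m 2 3 + m 4 5 + m 6 7; m 3 1 + m 4 6 - m 5 7;
    m 1 2 - m 4 7 - m 5 6; m 5 1 + m 6 2 - m 7 3; m 1 4 - m 7 2 - m 6 3;
    m 7 1 + m 2 4 - m 3 5; m 1 6 - m 2 5 - m 3 4] k.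
Proof. by move=> k7 /=; rewrite !mxE inordK. Qed.

Ltac coords := apply: row7P;
  do 7?[case=> [_|]]; last by [];
  rewrite ?row_linE ?dotE ?crossE //= /minor /= ?crossE //= /minor /= ?row_linE.

Lemma crossC x y : cross x y = - cross y x. Proof. by coords; ring. Qed.
Lemma crossDr x y z : cross z (x + y) = cross z x + cross z y.
Proof. by coords; ring. Qed.
Lemma crossZr k x y : cross x (k *: y) = k *: cross x y.
Proof. by coords; ring. Qed.
Lemma crossNr x y : cross x (- y) = - cross x y.
Proof. by coords; ring. Qed.
Lemma cross_dot x y z : dot (cross x y) z = dot x (cross y z).
Proof. by rewrite !dotE !crossE //= /minor /=; ring. Qed.
Lemma crossxx x : cross x x = 0. Proof. by coords; ring. Qed.
(** Polarization of the identity that [cross x] squares to minus [dot x x] off [x]. It replaces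
    associativity: the later identities permute iterated cross products with it instead of returning
    to coordinates. *)
Lemma cross_anti x y z : cross x (cross y z) =
  - cross y (cross x z) - (2 * dot x y) *: z + dot y z *: x + dot x z *: y.
Proof. by coords; ring. Qed.

Lemma dx_rows4E i j k l x y z w : let m := minor in
  dx i j k l (rows4 x y z w) =
  m x y i j * m z w k l - m x y i k * m z w j l + m x y i l * m z w j k
  + m x y j k * m z w i l - m x y j l * m z w i k + m x y k l * m z w i j.
Proof. by rewrite /dx det4E /= !mxE !inordK. Qed.

Lemma triple_crossE x y z :
  triple_cross x y z = - cross x (cross y z) - dot x y *: z + dot x z *: y.
Proof.
(* The triple product is known through its pairings, so the two sides are compared against every
   [w]; pairing their difference with itself then shows that it vanishes. *)
suff H w : dot (triple_cross x y z) w =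
    dot (- cross x (cross y z) - dot x y *: z + dot x z *: y) w.
  by apply/eqP; rewrite -subr_eq0; apply/eqP/dot_eq0; rewrite dotDl dotNl H subrr.
rewrite triple_crossP /starphi !dx_rows4E !dotE !row_linE !crossE //= /minor /= .
rewrite !crossE //= /minor /=; ring.
Qed.
End G2Algebra.

Ltac vring := apply/rowP => ?; rewrite ?row_linE; ring.

(** * Identities of the triple cross product *)

Section TripleCross.
Variable R : realType.
Implicit Types x y z a b p q : 'rV[R]_7.

(** This is [cross_anti] on the diagonal, divided by 2. *)
Lemma cross_sq x y : cross x (cross x y) = - dot x x *: y + dot x y *: x.
Proof.
have := cross_anti x x y; set v := cross _ _ => /rowP v2; apply/rowP => j.
by have := v2 j; rewrite !row_linE; lra.
Qed.

Lemma cross_skew x y z : dot (cross x y) z = - dot y (cross x z).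
Proof. by rewrite cross_dot crossC dotNr -cross_dot dotC. Qed.

Lemma triple_crossD x y z z' :
  triple_cross x y (z + z') = triple_cross x y z + triple_cross x y z'.
Proof. by rewrite !triple_crossE !crossDr !dot_linE; vring. Qed.

Lemma triple_crossZ x y k z : triple_cross x y (k *: z) = k *: triple_cross x y z.
Proof. by rewrite !triple_crossE !crossZr !dot_linE; vring. Qed.

Lemma triple_crossN x y z : triple_cross x y (- z) = - triple_cross x y z.
Proof. by rewrite -scaleN1r triple_crossZ scaleN1r. Qed.

Lemma triple_cross_swap12 x y z : triple_cross x y z = - triple_cross y x z.
Proof. by rewrite !triple_crossE cross_anti (dotC x y); vring. Qed.

Lemma triple_cross_swap23 x y z : triple_cross x y z = - triple_cross x z y.
Proof. by rewrite !triple_crossE (crossC y z) crossNr; vring. Qed.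

Lemma triple_cross_rot x y z : triple_cross x y z = triple_cross y z x.
Proof. by rewrite triple_cross_swap12 triple_cross_swap23 opprK. Qed.

Lemma triple_crossN1 x y z : triple_cross (- x) y z = - triple_cross x y z.
Proof. by rewrite triple_cross_rot triple_crossN -triple_cross_rot. Qed.

Lemma triple_crossN2 x y z : triple_cross x (- y) z = - triple_cross x y z.
Proof. by rewrite -triple_cross_rot triple_crossN triple_cross_rot. Qed.

Lemma triple_cross_eq12 x z : triple_cross x x z = 0.
Proof. by rewrite triple_crossE cross_sq; vring. Qed.

Lemma triple_cross_eq23 x z : triple_cross x z z = 0.
Proof. by rewrite triple_cross_rot triple_cross_eq12. Qed.

Lemma triple_cross_eq13 x z : triple_cross x z x = 0.
Proof. by rewrite triple_cross_swap12 triple_cross_eq23 oppr0. Qed.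

(** Taking adjoints reverses the order of the two cross products; [cross_anti] restores it, and the
    scalar terms match. *)
Lemma dot_triple_cross_skew x y z z' :
  dot (triple_cross x y z) z' = - dot z (triple_cross x y z').
Proof.
rewrite !triple_crossE (cross_anti x y z') !dot_linE !cross_skew.
by rewrite (dotC z x) (dotC z y); ring.
Qed.

Lemma dot_triple_cross_eq1 x y z : dot (triple_cross x y z) x = 0.
Proof. by rewrite dot_triple_cross_skew triple_cross_eq13 dotC dot0l oppr0. Qed.

Lemma dot_triple_cross_eq2 x y z : dot (triple_cross x y z) y = 0.
Proof. by rewrite dot_triple_cross_skew triple_cross_eq23 dotC dot0l oppr0. Qed.

Lemma dot_triple_cross_eq3 x y z : dot (triple_cross x y z) z = 0.
Proof. by have := dot_triple_cross_skew x y z z; rewrite (dotC z); lra. Qed.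

Definition orthonormal2 p q := [/\ dot p p = 1, dot q q = 1 & dot p q = 0].

Definition in_span p q x := exists al be, x = al *: p + be *: q.

Lemma in_spanD p q x y : in_span p q x -> in_span p q y -> in_span p q (x + y).
Proof.
by move=> [a [b ->]] [c [d ->]]; exists (a + c), (b + d); vring.
Qed.

Lemma in_spanZ p q k x : in_span p q x -> in_span p q (k *: x).
Proof. by move=> [a [b ->]]; exists (k * a), (k * b); vring. Qed.

Lemma in_spanN p q x : in_span p q x -> in_span p q (- x).
Proof. by rewrite -scaleN1r; exact: in_spanZ. Qed.

Lemma in_spanC p q x : in_span p q x -> in_span q p x.
Proof. by move=> [a [b ->]]; exists b, a; rewrite addrC. Qed.

Lemma triple_cross_span p q x : in_span p q x -> triple_cross p q x = 0.
Proof.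
move=> [a [b ->]]; rewrite triple_crossD !triple_crossZ.
by rewrite triple_cross_eq13 triple_cross_eq23 !scaler0 addr0.
Qed.

(* The orthogonal complement of the associative plane spanned by p, q and
   their cross product; it contains the image of [triple_cross p q]. *)
Definition normal3 p q x := [/\ dot p x = 0, dot q x = 0 & dot (cross p q) x = 0].

Lemma orthonormal2C p q : orthonormal2 p q -> orthonormal2 q p.
Proof. by move=> [? ? ?]; split=> //; rewrite dotC. Qed.

Lemma normal3C p q x : normal3 p q x -> normal3 q p x.
Proof. by move=> [? ? n]; split=> //; rewrite crossC dotNl n oppr0. Qed.

(** For the third condition, moving [cross p] to the other side of the pairing turns [cross p q]
    into [- q] up to sign, and [q] is orthogonal to [cross q x]. *)
Lemma normal3_triple_cross p q x :
  orthonormal2 p q -> normal3 p q (triple_cross p q x).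
Proof.
move=> [pp qq pq]; split.
- by rewrite dotC dot_triple_cross_eq1.
- by rewrite dotC dot_triple_cross_eq2.
have qN : dot (cross p q) q = 0 by rewrite cross_dot crossxx dotC dot0l.
have qqx : dot (cross q x) q = 0.
  by rewrite dotC -cross_dot crossxx dot0l.
rewrite triple_crossE pq scale0r subr0 !dot_linE qN dotC cross_skew cross_sq.
by rewrite pp pq !dot_linE qqx; ring.
Qed.

Variables p q : 'rV[R]_7.
Hypothesis pq_orthonormal : orthonormal2 p q.

Local Notation J := (triple_cross p q).

Lemma normal3_JE x : normal3 p q x -> J x = - cross p (cross q x).
Proof.
move: pq_orthonormal => [pp qq pq] [px _ _].
by rewrite triple_crossE pq px !scale0r oppr0 !addr0.
Qed.

(** Anticommuting [b] past [p] shows that [cross (J b) b] is a multiple of [cross p q], which a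
    further product with [p] sends to a multiple of [q]. *)
Lemma triple_cross_J_diag b : normal3 p q b ->
  triple_cross p (J b) b = - dot b b *: q.
Proof.
move: pq_orthonormal => [pp qq pq] nb; have [pb qb Nb] := nb.
have bqb : dot b (cross q b) = 0 by rewrite dotC cross_dot crossxx dotC dot0l.
have pqb : dot p (cross q b) = 0 by rewrite -cross_dot.
have sq : cross b (cross q b) = dot b b *: q.
  by rewrite (crossC q b) crossNr cross_sq (dotC b q) qb; vring.
have JbE : cross (J b) b = - dot b b *: cross p q.
  rewrite crossC normal3_JE // crossNr opprK cross_anti sq crossZr bqb pqb.
  by rewrite (dotC b p) pb; vring.
rewrite triple_crossE JbE crossZr cross_sq pb pp pq dotC dot_triple_cross_eq1.
by vring.
Qed.

(** Both terms reduce to [y = cross b a]. The first is [- cross p y]; in the second, anticommuting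
    [b] past [p] and [q] produces [cross p y] up to terms in [p], [q] and [cross q p]. *)
Lemma triple_cross_J_sym a b : normal3 p q a -> normal3 p q b ->
  in_span p q (triple_cross p b a + triple_cross (J a) q b).
Proof.
move: pq_orthonormal => [pp qq pq] na nb.
have [pa qa Na] := na; have [pb qb Nb] := nb.
have Ja0 : dot q (J a) = 0 by rewrite dotC dot_triple_cross_eq2.
have pqa : dot p (cross q a) = 0 by rewrite -cross_dot.
set y := cross b a.
have e1 : triple_cross p b a = - cross p y.
  by rewrite triple_crossE pb pa; vring.
have e2 : triple_cross (J a) q b = cross q (cross b (cross p (cross q a))).
  rewrite triple_cross_rot triple_crossE qb Ja0 normal3_JE //.
  by rewrite !crossNr; vring.
have e3 : cross b (cross p (cross q a)) =
    - cross p (cross b (cross q a)) + dot b (cross q a) *: p.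
  by rewrite cross_anti (dotC b p) pb pqa; vring.
have e4 : cross b (cross q a) = - cross q y + dot b a *: q.
  by rewrite cross_anti (dotC b q) qb qa; vring.
have e5 : cross q (cross p (cross q y)) =
    cross p y - dot q (cross p y) *: q + dot q y *: cross q p.
  rewrite (cross_anti p q y) pq !(crossDr, crossNr, crossZr) cross_sq qq.
  by rewrite crossxx; vring.
have e6 : cross q (cross p q) = p.
  by rewrite (crossC p q) crossNr cross_sq qq (dotC q p) pq; vring.
(* This makes the two multiples of [cross q p], from [e3] and [e5], cancel, leaving only multiples
   of [p] and [q]. *)
have c : dot b (cross q a) = - dot q y.
  by rewrite dotC cross_dot (crossC a b) dotNr.
exists (- dot b a), (- dot q (cross p y)).
rewrite e1 e2 e3 e4 !(crossDr, crossNr, crossZr) e5 e6 c.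
by vring.
Qed.
End TripleCross.

(** * Calibrated frames *)

Section RuledAlgebra.
Variable R : realType.
Implicit Types x y z a b p q X Y : 'rV[R]_7.

(* The terms of [psi_t - J psi_s] that survive the product rule group into
   [triple_cross_J_diag] and [triple_cross_J_sym], once for (p, q) and once
   for (q, p). *)
Lemma ruling_span p q a b a' b' pss pst ptt qss qst qtt u v us ut vs vt :
  orthonormal2 p q ->
  let J := triple_cross p q in
  a' = J a -> a = - J a' -> b' = J b -> b = - J b' ->
  pst = triple_cross a q a + triple_cross p b a + J pss ->
  ptt = triple_cross a' q a + triple_cross p b' a + J pst ->
  qst = triple_cross a q b + triple_cross p b b + J qss ->
  qtt = triple_cross a' q b + triple_cross p b' b + J qst ->
  us = vt -> ut = - vs ->
  in_span p q
    (ut *: a + vt *: a' - vt *: b + ut *: b'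
       + (u *: pst + v *: ptt - v *: qst + u *: qtt)
     - J (us *: a + vs *: a' - vs *: b + us *: b'
       + (u *: pss + v *: pst - v *: qss + u *: qst))).
Proof.
move=> on J a'E aE b'E bE pstE pttE qstE qttE -> ->.
have nJ x : normal3 p q (J x) by exact: normal3_triple_cross.
have nN x : normal3 p q x -> normal3 p q (- x).
  by move=> [h1 h2 h3]; split; rewrite dotNr ?h1 ?h2 ?h3 oppr0.
have na : normal3 p q a by rewrite aE; exact/nN/nJ.
have nb : normal3 p q b by rewrite bE; exact/nN/nJ.
have Ja' : J a' = - a by rewrite aE opprK.
have Jb' : J b' = - b by rewrite bE opprK.
have J' x : triple_cross q p x = - J x by exact: triple_cross_swap12.
have U : in_span p q (triple_cross p b a + triple_cross a' q b
    + triple_cross p b' b).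
  rewrite a'E b'E; apply: in_spanD; first exact: triple_cross_J_sym.
  rewrite (triple_cross_J_diag on nb); exists 0, (- dot b b).
  by rewrite scale0r add0r.
have V : in_span p q (triple_cross a' q a + triple_cross p b' a
    - triple_cross a q b).
  have := triple_cross_J_sym (orthonormal2C on) (normal3C nb) (normal3C na).
  have := triple_cross_J_diag (orthonormal2C on) (normal3C na).
  rewrite !J' => d /in_spanC s; rewrite a'E b'E.
  have -> : triple_cross (J a) q a = - dot a a *: p.
    by rewrite -d triple_crossN2 -triple_cross_swap12.
  rewrite -addrA; apply: in_spanD; first by exists (- dot a a), 0; vring.
  move: s; rewrite triple_crossN1 (triple_cross_swap12 (J b) p) opprK.
  by rewrite (triple_cross_swap12 q a) addrC.
move: (in_spanD (in_spanZ u U) (in_spanZ v V)); congr in_span.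
rewrite pttE qttE pstE qstE.
have JD x y : J (x + y) = J x + J y by exact: triple_crossD.
have JN x : J (- x) = - J x by exact: triple_crossN.
have JZ k x : J (k *: x) = k *: J x by exact: triple_crossZ.
rewrite triple_cross_eq13 triple_cross_eq23 add0r addr0.
rewrite !(JD, JN, JZ) Ja' Jb' -a'E -b'E; vring.
Qed.

(* The second conclusion is the first one in the rotated coordinates (t, -s). *)
Lemma ruling_span2 p q a b a' b' pss pst pts ptt qss qst qts qtt
    u v us ut vs vt psis psit :
  orthonormal2 p q ->
  let J := triple_cross p q in
  a' = J a -> a = - J a' -> b' = J b -> b = - J b' ->
  pst = triple_cross a q a + triple_cross p b a + J pss ->
  pss = - (triple_cross a q a' + triple_cross p b a' + J pst) ->
  ptt = triple_cross a' q a + triple_cross p b' a + J pts ->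
  pts = - (triple_cross a' q a' + triple_cross p b' a' + J ptt) ->
  qst = triple_cross a q b + triple_cross p b b + J qss ->
  qss = - (triple_cross a q b' + triple_cross p b b' + J qst) ->
  qtt = triple_cross a' q b + triple_cross p b' b + J qts ->
  qts = - (triple_cross a' q b' + triple_cross p b' b' + J qtt) ->
  pts = pst -> qts = qst -> us = vt -> ut = - vs ->
  psis = u *: pss + us *: a + (v *: pst + vs *: a')
    + (- v *: qss + - vs *: b + (u *: qst + us *: b')) ->
  psit = u *: pts + ut *: a + (v *: ptt + vt *: a')
    + (- v *: qts + - vt *: b + (u *: qtt + ut *: b')) ->
  in_span p q (psit - J psis) /\ in_span p q (psis + J psit).
Proof.
move=> on J a'E aE b'E bE p1 p2 p3 p4 q1 q2 q3 q4 ps qs CR1 CR2 sE tE.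
rewrite ps qs in p3 p4 q3 q4 tE; split.
  have := ruling_span u v on a'E aE b'E bE p1 p3 q1 q3 CR1 CR2.
  congr in_span; rewrite sE tE; congr (_ - triple_cross p q _); vring.
have JN x : J (- x) = - J x by exact: triple_crossN.
have r1 : - a = J a' by rewrite {1}aE opprK.
have r2 : a' = - J (- a) by rewrite JN opprK.
have r3 : - b = J b' by rewrite {1}bE opprK.
have r4 : b' = - J (- b) by rewrite JN opprK.
have e1 : - pst = triple_cross a' q a' + triple_cross p b' a' + J ptt.
  by rewrite p4 opprK.
have e2 : pss = triple_cross (- a) q a' + triple_cross p (- b) a' + J (- pst).
  by rewrite p2 JN triple_crossN1 triple_crossN2 !opprD.
have e3 : - qst = triple_cross a' q b' + triple_cross p b' b' + J qtt.
  by rewrite q4 opprK.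
have e4 : qss = triple_cross (- a) q b' + triple_cross p (- b) b' + J (- qst).
  by rewrite q2 JN triple_crossN1 triple_crossN2 !opprD.
have CR3 : vt = us by [].
have CR4 : - vs = - - ut by rewrite CR2 opprK.
have := ruling_span v (- u) on r1 r2 r3 r4 e1 e2 e3 e4 CR3 CR4.
move=> /in_spanN; congr in_span; rewrite opprB addrC; congr (_ + _).
  by rewrite sE; vring.
by congr (triple_cross p q _); rewrite tE; vring.
Qed.

Lemma starphi_mul (C : 'M[R]_4) (E : 'M[R]_(4, 7)) :
  starphi (C *m E) = \det C * starphi E.
Proof.
have H i j k l : dx i j k l (C *m E) = \det C * dx i j k l E.
  rewrite /dx -det_mulmx; congr (\det _); apply/matrixP => s t.
  by rewrite !mxE; apply: eq_bigr => m _; rewrite !mxE.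
by rewrite /starphi !H; ring.
Qed.

Section Frame.
Variables p q X Y : 'rV[R]_7.
Hypothesis on : orthonormal2 p q.
Local Notation J := (triple_cross p q).
Hypothesis XY : in_span p q (Y - J X).
Hypothesis YX : in_span p q (X + J Y).

(** Since [J] kills the span, [J Y = J (J X)] and [J X = - J (J Y)]; skew-adjointness of [J] then
    carries one squared length to the other. *)
Lemma dot_J_frame : dot (J Y) (J Y) = dot (J X) (J X).
Proof.
have := triple_cross_span XY; rewrite triple_crossD triple_crossN => /eqP.
rewrite subr_eq0 => /eqP YE.
have := triple_cross_span YX; rewrite triple_crossD => /eqP.
rewrite addr_eq0 => /eqP XE.
by rewrite {1}YE dot_triple_cross_skew -dotNr -XE.
Qed.

(** Modulo [p] and [q] the last two rows are [- J Y] and [J X]. These are orthogonal to [p], to [q]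
    and to each other, and have equal length. *)
Lemma gram_frame :
  \det (rows4 p q X Y *m (rows4 p q X Y)^T) = dot (J X) (J X) ^+ 2.
Proof.
have E i j : (rows4 p q X Y *m (rows4 p q X Y)^T) i j =
    dot (nth 0 [:: p; q; X; Y] i) (nth 0 [:: p; q; X; Y] j).
  by rewrite !mxE; apply: eq_bigr => k _; rewrite !mxE.
rewrite det4E !E !inordK //=.
have [al [be YE]] := XY; have [ga [de XE]] := YX.
have {}YE : Y = J X + al *: p + be *: q by rewrite -addrA -YE addrC subrK.
have {}XE : X = - J Y + ga *: p + de *: q by rewrite -addrA -XE addrC addrK.
have [pp qq pq] := on.
have oJ x : (dot (J x) p = 0) * (dot (J x) q = 0).
  by rewrite dot_triple_cross_eq1 dot_triple_cross_eq2.
have JXJY : dot (J X) (J Y) = 0.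
  have JE : J X = - J (J Y).
    by rewrite {1}XE !(triple_crossD, triple_crossZ, triple_crossN)
     triple_cross_eq13 triple_cross_eq23 !scaler0 !addr0.
  by rewrite JE dotNl dot_triple_cross_eq3 oppr0.
have dX x : dot X x = - dot (J Y) x + ga * dot p x + de * dot q x.
  by rewrite {1}XE !dot_linE.
have dY x : dot Y x = dot (J X) x + al * dot p x + be * dot q x.
  by rewrite {1}YE !dot_linE.
rewrite !(dotC p) !(dotC q) (dotC X Y) !(dX, dY) !(dotC (J _) X) !(dotC (J _) Y).
rewrite !(dX, dY) !(dotC p) !(dotC q) !(dX,dY) (dotC (J Y) (J X)) JXJY.
rewrite !oJ (dotC q p) pq pp qq dot_J_frame; ring.
Qed.

(** The left side is [dot (J X) Y], and [J X] is orthogonal to the [p] and [q] parts of [Y]. *)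
Lemma starphi_frame : starphi (rows4 p q X Y) = dot (J X) (J X).
Proof.
rewrite -triple_crossP; have [al [be YE]] := XY.
have {}YE : Y = J X + (al *: p + be *: q) by rewrite -YE addrC subrK.
rewrite {1}YE !dotDr !dotZr dot_triple_cross_eq1 dot_triple_cross_eq2.
by rewrite !mulr0 !addr0.
Qed.

(** The common value for [C = 1] is the squared length of [J X], so the sign is always positive and
    both sides vanish on dependent rows. *)
Lemma calibrated_frame (C : 'M[R]_4) (E := rows4 p q X Y) :
  starphi (C *m E) = \det C * Num.sqrt (\det (E *m E^T)).
Proof.
rewrite starphi_mul starphi_frame gram_frame sqrtr_sqr ger0_norm //.
by apply: sumr_ge0 => i _; rewrite -expr2 sqr_ge0.
Qed.

Lemma rank_frame : J X <> 0 -> \rank (rows4 p q X Y) = 4%N.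
Proof.
move=> JX0; have : (rows4 p q X Y *m (rows4 p q X Y)^T) \in unitmx.
  rewrite unitmxE gram_frame unitfE expf_eq0 /=; apply/eqP => h.
  exact/JX0/dot_eq0.
rewrite -row_free_unit -row_leq_rank => h; apply/eqP.
rewrite eqn_leq rank_leq_row /=; apply: leq_trans h _.
exact: mxrankM_maxl.
Qed.

(** Used for the frames of the cone, to see that [J] does not kill the derivative of [phi1]. *)
Lemma rank_frame_notin_span : \rank (rows4 p q X Y) = 4%N -> ~ in_span p q X.
Proof.
move=> r4 [al [be XE]]; have : row_free (rows4 p q X Y).
  by rewrite -row_leq_rank r4.
(* The coefficients of the relation [al *: p + be *: q - X = 0] among the rows; its third entry, -1,
   gives the contradiction. *)
pose v : 'rV[R]_4 := \row_i nth 0 [:: al; be; -1; 0] i.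
move=> /row_freeP [B EB].
have : v *m rows4 p q X Y = 0.
  apply/rowP => j; rewrite !mxE !big_ord_recr big_ord0 /= !mxE /= XE !mxE.
  ring.
move=> /(congr1 (mulmx^~ B)); rewrite -mulmxA EB mulmx1 mul0mx.
move=> /rowP /(_ (inord 2)); rewrite !mxE inordK //= => /eqP.
by rewrite oppr_eq0 oner_eq0.
Qed.
End Frame.

End RuledAlgebra.

(** The terms in [r1] and [r2] satisfy the two relations exactly, by the gauge equations, so the
    condition on a frame falls on the derivatives [s], [t] of [psi] alone. *)
Lemma in_span_affine (R : realType) (p q a b a' b' s t : 'rV[R]_7) (r1 r2 : R)
    (J := triple_cross p q) :
  a' = J a -> a = - J a' -> b' = J b -> b = - J b' ->
  in_span p q (t - J s) -> in_span p q (s + J t) ->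
  in_span p q (r1 *: a' + r2 *: b' + t - J (r1 *: a + r2 *: b + s)) /\
  in_span p q (r1 *: a + r2 *: b + s + J (r1 *: a' + r2 *: b' + t)).
Proof.
move=> h1 h2 h3 h4 k1 k2.
have JE x y z : J (r1 *: x + r2 *: y + z) = r1 *: J x + r2 *: J y + J z.
  by rewrite /J !triple_crossD !triple_crossZ.
rewrite !JE -h1 -h3; split.
  by move: k1; congr in_span; vring.
by move: k2; congr in_span; rewrite h2 h4; vring.
Qed.

(** Makes the immersion criterion [J X <> 0] independent of the chart, whose change replaces [X] by
    a combination of [X] and [Y]. *)
Lemma triple_cross_frame_eq0 (R : realType) (p q X Y : 'rV[R]_7) (al be : R)
    (J := triple_cross p q) :
  in_span p q (Y - J X) -> J X = 0 -> J (al *: X + be *: Y) = 0.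
Proof.
move=> k JX; have := triple_cross_span k; rewrite JX subr0 => JY.
rewrite /J triple_crossD !triple_crossZ JY [triple_cross p q X]JX.
by rewrite !scaler0 addr0.
Qed.

(** * Differential calculus *)

Section Analysis.
Variable R : realType.

Lemma derive_line (V W : normedModType R) (f : V -> W) x v :
  'D_v f x = 'D_1 (fun h : R => f (h *: v + x)) 0.
Proof.
rewrite /derive; set g1 := fun h => h^-1 *: _; set g2 := fun h => h^-1 *: _.
suff -> : g1 = g2 by [].
by rewrite funeqE /g1 /g2 => h /=; rewrite addr0 scale0r add0r [_%:A]mulr1.
Qed.

(** On the line through [x], [g] becomes a function of one real variable, for which derivability is
    differentiability; the chain rule for differentials then applies. *)
Lemma is_derive_comp (U V W : normedModType R) (g : U -> V) (f : V -> W) x v dg :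
  is_derive x v g dg -> differentiable f (g x) ->
  is_derive x v (f \o g) ('d f (g x) dg).
Proof.
move=> [dgx gE] df; pose l (h : R) := g (h *: v + x).
have l0 : l 0 = g x by rewrite /l scale0r add0r.
have dl : differentiable l 0.
  by apply/derivable1_diffP; exact: (derivable1P g x v).1.
have dfl : differentiable (f \o l) 0.
  by apply: differentiable_comp => //; rewrite l0.
apply: DeriveDef.
  by apply/derivable1P/derivable1_diffP; exact: dfl.
rewrite derive_line -[fun h => _]/(f \o l) deriveE // diff_comp ?l0 //=.
by congr ('d f (g x) _); rewrite -gE (derive_line g x v) -deriveE.
Qed.

Lemma is_derive_line (V W : normedModType R) (f : V -> W) v c (x : R) :
  differentiable f (x *: v + c) ->
  is_derive x 1 (fun y => f (y *: v + c)) ('D_v f (x *: v + c)).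
Proof.
move=> df; have dl : is_derive x (1 : R) (fun y : R => y *: v + c) v.
  apply: DeriveDef.
    by apply: derivableD; [exact/derivable1_diffP|exact: derivable_cst].
  rewrite deriveD; [|exact/derivable1_diffP|exact: derivable_cst].
  by rewrite derive_cst addr0 deriveE // diff_val scale1r.
by have := is_derive_comp dl df; rewrite -deriveE.
Qed.

(** The mean value theorem in the direction [v] turns the second difference into a first difference
    of ['D_v f], which is then expanded to first order at [p]. *)
Lemma second_difference (V : normedModType R) (f : V -> R) p v w (e : R) :
  0 < e -> (\forall x \near p, differentiable f x) ->
  differentiable ('D_v f) p ->
  \forall h \near (0 : R)^'+,
    `| f (h *: v + (h *: w + p)) - f (h *: v + p) - (f (h *: w + p) - f p)
       - h * h * 'D_w ('D_v f) p | <= e * (h * h).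
Proof.
move=> e0 df dg; set g := 'D_v f.
(* For [x] between 0 and [h], [h * n] bounds the sum of the norms of [x *: v + h *: w] and [x *: v],
   the two increments at which ['D_v f] is expanded; the 1 keeps [n] positive. *)
pose n := 2 * `|v| + `|w| + 1.
have n0 : 0 < n by rewrite /n ltr_wpDl // addr_ge0 // mulr_ge0.
have [d1 d10 Hd1] : exists2 d : R, 0 < d & forall k : V, `|k| < d ->
    `|g (k + p) - g p - 'd g p k| <= e / n * `|k|.
  have en : 0 < e / n by rewrite divr_gt0.
  have /eqaddoP /(_ _ en) := diff_locally dg.
  move=> /nbhs_ballP[d /= d0 Hd]; exists d => // k kd.
  have /= := Hd k; rewrite -ball_normE /ball_ /= sub0r normrN => /(_ kd).
  by rewrite opprD addrA.
have [d2 d20 Hd2] : exists2 d : R, 0 < d & forall k : V, `|k| < d ->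
    differentiable f (k + p).
  have /nbhs_ballP[d /= d0 Hd] := df; exists d => // k kd; apply: Hd.
  by rewrite -ball_normE /ball_ /= opprD addrCA subrr addr0 normrN.
near=> h.
have h0 : 0 < h by near: h; exact: nbhs_right_gt.
have hd : h * n < Num.min d1 d2.
  rewrite -ltr_pdivlMr //; near: h; apply: nbhs_right_lt.
  by rewrite divr_gt0 // lt_min d10 d20.
have small (x : R) : 0 <= x <= h -> `|x *: v + h *: w| < Num.min d1 d2 /\
    `|x *: v| < Num.min d1 d2.
  move=> /andP[x0 xh].
  have xv : `|x *: v| <= h * `|v|.
    by rewrite normrZ ger0_norm // ler_wpM2r.
  have hw : `|h *: w| = h * `|w| by rewrite normrZ gtr0_norm.
  have hv0 : 0 <= h * `|v| by rewrite mulr_ge0 // ltW.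
  have hw0 : 0 <= h * `|w| by rewrite mulr_ge0 // ltW.
  have nE : h * n = 2 * (h * `|v|) + h * `|w| + h by rewrite /n; ring.
  split; apply: le_lt_trans hd; rewrite nE; last by lra.
  by apply: (le_trans (ler_normD _ _)); rewrite hw; lra.
pose phi (x : R) := f (x *: v + (h *: w + p)) - f (x *: v + p).
pose dphi (x : R) := g (x *: v + (h *: w + p)) - g (x *: v + p).
have dph x : 0 <= x <= h -> is_derive x 1 phi (dphi x).
  move=> /small[]; rewrite !lt_min => /andP[_ s1] /andP[_ s2].
  apply: is_deriveB; apply: is_derive_line; last exact: Hd2.
  by rewrite addrA; exact: Hd2.
have [] := @MVT _ phi dphi 0 h h0.
- by move=> x; rewrite in_itv /= => /andP[x0 xh]; apply: dph; rewrite !ltW.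
- apply: derivable_within_continuous => x; rewrite in_itv /= => /dph dx.
  exact: ex_derive.
move=> xi; rewrite in_itv /= => /andP[xi0 xih].
rewrite subr0 {1 2}/phi !scale0r !add0r => ->.
have /small[] : 0 <= xi <= h by rewrite !ltW.
rewrite !lt_min => /andP[/Hd1 s1 _] /andP[/Hd1 s2 _].
rewrite deriveE // -/g /dphi.
rewrite linearD !linearZ /= in s1; rewrite linearZ /= in s2.
(* Subtracting the two expansions cancels the terms in ['d g p v] and leaves [h * 'd g p w]. *)
rewrite [X in `|X|](_ : _ = h * ((g (xi *: v + h *: w + p) - g p -
    (xi *: 'd g p v + h *: 'd g p w)) -
    (g (xi *: v + p) - g p - xi *: 'd g p v))); last first.
  by rewrite addrA /GRing.scale /=; ring.
rewrite normrM gtr0_norm // (mulrC h) mulrA ler_pM2r //.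
apply: (le_trans (ler_normB _ _)).
apply: (le_trans (lerD s1 s2)).
rewrite -mulrDr -mulrA ler_pM2l //.
rewrite mulrC ler_pdivrMr //.
have xv : `|xi *: v| <= h * `|v|.
  by rewrite normrZ gtr0_norm // ler_wpM2r // ltW.
have hw : `|h *: w| = h * `|w| by rewrite normrZ gtr0_norm.
have nE : h * n = 2 * (h * `|v|) + h * `|w| + h by rewrite /n; ring.
rewrite nE; apply: (le_trans (lerD (ler_normD _ _) (lexx _))).
by rewrite hw; lra.
Unshelve. all: by end_near. Qed.

(** The second difference is symmetric in [v] and [w], so after division by [h * h] it approximates
    both mixed derivatives. *)
Lemma derive_sym (V : normedModType R) (f : V -> R) p v w :
  (\forall x \near p, differentiable f x) ->
  differentiable ('D_v f) p -> differentiable ('D_w f) p ->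
  'D_w ('D_v f) p = 'D_v ('D_w f) p.
Proof.
move=> df dv dw; apply/eqP; rewrite -subr_eq0 -normr_le0.
apply/ler_addgt0Pr => e e0; rewrite add0r.
have e20 : 0 < e / 2 by rewrite divr_gt0.
have S1 := second_difference w e20 df dv.
have S2 := second_difference v e20 df dw.
have [h [[h0 H1] H2]] :=
  filter_ex (filterI (filterI (nbhs_right_gt (0 : R)) S1) S2).
have hh0 : 0 < h * h by rewrite mulr_gt0.
move: H1 H2; rewrite (addrCA (h *: w)).
set a := 'D_w _ p; set b := 'D_v _ p; set A := f (_ + (_ + _)).
set B := f (h *: v + p); set C := f (h *: w + p); set D := f p.
move: a b A B C D => a b A B C D H1 H2.
have : `|(h * h) * (a - b)| <= e * (h * h).
  rewrite (_ : _ * (a - b) =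
    (A - C - (B - D) - h * h * b) - (A - B - (C - D) - h * h * a)); last by ring.
  apply: (le_trans (ler_normB _ _)); apply: (le_trans (lerD H2 H1)).
  by rewrite -mulrDl -splitr.
by rewrite normrM (gtr0_norm hh0) mulrC ler_pM2r.
Qed.
End Analysis.

(** * Derivatives of vector-valued maps *)

Section VectorCalculus.
Variables (R : realType) (V : normedModType R).

Lemma is_derive_row n (F : V -> 'rV[R]_n) x v (dF : 'rV[R]_n) :
  (forall j, is_derive x v (fun y => F y 0 j) (dF 0 j)) -> is_derive x v F dF.
Proof.
move=> H; have d : derivable F x v.
  by apply/derivable_mxP => i j; rewrite (ord1 i); have [] := H j.
apply: DeriveDef => //; rewrite derive_mx //; apply/rowP => j.
by rewrite mxE; have [] := H j.
Qed.

Lemma is_derive_coord n (F : V -> 'rV[R]_n) x v (dF : 'rV[R]_n) j :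
  is_derive x v F dF -> is_derive x v (fun y => F y 0 j) (dF 0 j).
Proof.
move=> [d <-]; apply: DeriveDef; first exact/(derivable_mxP _ _ _).1.
by rewrite derive_mx // mxE.
Qed.

Lemma is_derive_scale n (k : V -> R) (F : V -> 'rV[R]_n) x v dk dF :
  is_derive x v k dk -> is_derive x v F dF ->
  is_derive x v (fun y => k y *: F y) (k x *: dF + dk *: F x).
Proof.
move=> hk hF; apply: is_derive_row => j.
have -> : (fun y => (k y *: F y) 0 j) = k * (fun y => F y 0 j).
  by apply/funext => y; rewrite mxE.
have := is_deriveM hk (is_derive_coord j hF); congr is_derive.
by rewrite !mxE /GRing.scale /= (mulrC dk).
Qed.

Lemma is_derive_sumE n (I : finType) (F : I -> V -> 'rV[R]_n) x v dF :
  (forall i, is_derive x v (F i) (dF i)) ->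
  is_derive x v (fun y => \sum_i F i y) (\sum_i dF i).
Proof.
move=> H; apply: is_derive_row => j.
rewrite (_ : (fun _ => _) = (fun y => \sum_i F i y 0 j)); last first.
  by apply/funext => y; rewrite summxE.
rewrite summxE; elim: (index_enum I) => [|i r IH].
  by under eq_fun do rewrite big_nil; rewrite big_nil; exact: is_derive_cst.
under eq_fun do rewrite big_cons; rewrite big_cons.
exact: is_deriveD (is_derive_coord j (H i)) IH.
Qed.

(** Expanding [f y] in the standard basis leaves scalar multiples of the maps [T (delta_mx 0 i)],
    whose linear argument is constant. A multilinear map can thus be differentiated one argument at
    a time. *)
Lemma is_derive_linear_arg n m (T : 'rV[R]_n -> V -> 'rV[R]_m)
    (T' : 'rV[R]_n -> 'rV[R]_m) (f : V -> 'rV[R]_n) x v df :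
  (forall y, linear (T ^~ y)) -> linear T' ->
  is_derive x v f df -> (forall e, is_derive x v (T e) (T' e)) ->
  is_derive x v (fun y => T (f y) y) (T' (f x) + T df x).
Proof.
have dec (G : 'rV[R]_n -> 'rV[R]_m) e : linear G ->
    G e = \sum_i e 0 i *: G (delta_mx 0 i).
  move=> lG; pose GL : {linear 'rV[R]_n -> 'rV[R]_m} :=
    HB.pack G (GRing.isLinear.Build _ _ _ _ _ lG).
  rewrite -[G]/(GL : _ -> _) {1}(row_sum_delta e) linear_sum.
  by apply: eq_bigr => i _; rewrite linearZ.
move=> lT lT' hf hT.
rewrite (_ : (fun y => _) = fun y => \sum_i f y 0 i *: T (delta_mx 0 i) y);
  last by apply/funext => y; exact: (dec (T ^~ y)).
rewrite (dec T' (f x) lT') (dec (T ^~ x) df (lT x)) -big_split /=.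
apply: is_derive_sumE => i; apply: is_derive_scale => //.
exact: is_derive_coord.
Qed.

Lemma differentiable_row n (F : V -> 'rV[R]_n) x :
  (forall j, differentiable (fun y => F y 0 j) x) -> differentiable F x.
Proof.
move=> H.
have -> : F = \sum_j (fun y => F y 0 j *: (delta_mx 0 j : 'rV[R]_n)).
  by apply/funext => y; rewrite fct_sumE {1}(row_sum_delta (F y)).
by apply: differentiable_sum => j; exact: differentiableZl.
Qed.

Lemma differentiable_scale n (k : V -> R) (F : V -> 'rV[R]_n) x :
  differentiable k x -> differentiable F x ->
  differentiable (fun y => k y *: F y) x.
Proof.
move=> hk hF; apply: differentiable_row => j.
have -> : (fun y => (k y *: F y) 0 j) = k * (fun y => F y 0 j).
  by apply/funext => y; rewrite mxE.
apply: differentiableM => //.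
apply: (@differentiable_comp _ _ _ _ F (fun M : 'rV[R]_n => M 0 j)) => //.
exact: differentiable_coord.
Qed.

Lemma is_derive_pair (W W' : normedModType R) (f : V -> W) (g : V -> W')
    x v df dg :
  is_derive x v f df -> is_derive x v g dg ->
  is_derive x v (fun y => (f y, g y)) (df, dg).
Proof.
move=> [f1 <-] [g1 <-].
suff H : h^-1 *: (((fun y => (f y, g y)) \o shift x) (h *: v) - (f x, g x))
    @[h --> (0:R)^'] --> ('D_v f x, 'D_v g x).
  by apply: DeriveDef; [apply/cvg_ex; eexists; exact: H|exact: cvg_lim].
exact: (cvg_pair f1 g1).
Qed.

Lemma is_derive_triple_cross (f g h : V -> 'rV[R]_7) x v df dg dh :
  is_derive x v f df -> is_derive x v g dg -> is_derive x v h dh ->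
  is_derive x v (fun y => triple_cross (f y) (g y) (h y))
    (triple_cross df (g x) (h x) + triple_cross (f x) dg (h x)
      + triple_cross (f x) (g x) dh).
Proof.
move=> hf hg hh.
have l3 a b : linear (triple_cross a b).
  by move=> k c d; rewrite triple_crossD triple_crossZ.
have l2 a c : linear (fun b => triple_cross a b c).
  by move=> k b d; rewrite -!(triple_cross_rot c a) l3.
have l1 b c : linear (fun a => triple_cross a b c).
  by move=> k a d; rewrite !(triple_cross_rot _ b c) l3.
have lD (F G : 'rV[R]_7 -> 'rV[R]_7) : linear F -> linear G ->
    linear (fun e => F e + G e).
  by move=> lF lG k a b; rewrite lF lG scalerDr addrACA.
(* The arguments are released from the last to the first: only [h] varies here, [g] and [h] in [H2],
   all three at the end. *)
have H3 a b : is_derive x v (fun y => triple_cross a b (h y))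
    (triple_cross a b dh).
  rewrite -[X in is_derive _ _ _ X]add0r.
  apply: (@is_derive_linear_arg _ _ (fun e _ => triple_cross a b e) (fun=> 0)) => //.
  by move=> k c d; rewrite scaler0 addr0.
have H2 a : is_derive x v (fun y => triple_cross a (g y) (h y))
    (triple_cross a (g x) dh + triple_cross a dg (h x)).
  by apply: (@is_derive_linear_arg _ _ (fun e y => triple_cross a e (h y))
    (fun e => triple_cross a e dh)).
rewrite (_ : _ + _ = triple_cross (f x) (g x) dh + triple_cross (f x) dg (h x)
    + triple_cross df (g x) (h x)); last by rewrite addrC [RHS]addrAC addrA.
apply: (@is_derive_linear_arg _ _ (fun e y => triple_cross e (g y) (h y))
    (fun e => triple_cross e (g x) dh + triple_cross e dg (h x))) => //.
exact: lD.
Qed.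

End VectorCalculus.

(** Near [p] both maps have the same first-order expansion, so the differential of [f] serves for
    [g]. *)
Lemma near_eq_differentiable (R : realType) (V W : normedModType R)
    (f g : V -> W) p :
  (\near p, f p = g p) -> differentiable f p -> differentiable g p.
Proof.
move=> fg /diff_locallyP[c e].
have fgp : f p = g p := nbhs_singleton fg.
have e' : g \o shift p = cst (g p) + 'd f p +o_ 0 id.
  apply/eqaddoP => eps eps0; move/eqaddoP: e => /(_ _ eps0).
  have fg0 : \forall h \near (0 : V), f (h + p) = g (h + p).
    by move: fg; rewrite (near_shift 0) /=; apply: filterS => h; rewrite /= subr0.
  apply: filterS2 fg0 => h h1.
  by rewrite -[X in `|X|]/(f (h + p) - (f p + 'd f p h)) h1 fgp.
have gE : 'd g p = 'd f p :> (V -> W) by exact: diff_unique.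
by apply/diff_locallyP; rewrite gE.
Qed.

(** * Closure properties of C^k maps *)

Section Ck.
Variables (R : realType) (U : set (R * R)%type).
Hypothesis oU : open U.

(** Since [U] is open, equality on [U] is equality near each of its points and passes to the
    derivatives. *)
Lemma Ck_congr (V : normedModType R) k (f g : R * R -> V) :
  (forall p, U p -> f p = g p) -> Ck k U f -> Ck k U g.
Proof.
have near_eq (f' g' : R * R -> V) p : (forall p, U p -> f' p = g' p) -> U p ->
    \near p, f' p = g' p.
  by move=> fg Up; apply: filterS (open_nbhs_nbhs (conj oU Up)).
elim: k f g => [|k IH] f g fg /=.
  move=> cf p Up; have fgp := near_eq _ _ _ fg Up.
  rewrite /prop_for /continuous_at -(fg p Up).
  apply: cvg_trans (cf p Up); apply: near_eq_cvg.
  by apply: filterS fgp => ? ->.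
move=> [df d1 d2]; split; last 2 first.
- by apply: IH d1 => p Up; exact/near_eq_derive/near_eq.
- by apply: IH d2 => p Up; exact/near_eq_derive/near_eq.
by move=> p Up; exact: near_eq_differentiable (near_eq _ _ _ fg Up) (df p Up).
Qed.

Lemma CkS (V : normedModType R) k (f : R * R -> V) : Ck k.+1 U f -> Ck k U f.
Proof.
elim: k f => [|k IH] f [df d1 d2].
  by move=> p Up; exact/differentiable_continuous/df.
by split; [exact: df|exact: IH d1|exact: IH d2].
Qed.

Lemma CkD (V : normedModType R) k (f g : R * R -> V) :
  Ck k U f -> Ck k U g -> Ck k U (fun p => f p + g p).
Proof.
elim: k f g => [|k IH] f g /=.
  by move=> cf cg p Up; apply: continuousD; [exact: cf|exact: cg].
move=> [df f1 f2] [dg g1 g2]; split.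
- by move=> p Up; apply: differentiableD; [exact: df|exact: dg].
- apply: Ck_congr (IH _ _ f1 g1) => p Up; rewrite deriveD //.
    exact/diff_derivable/df.
  exact/diff_derivable/dg.
apply: Ck_congr (IH _ _ f2 g2) => p Up; rewrite deriveD //.
  exact/diff_derivable/df.
exact/diff_derivable/dg.
Qed.

Lemma CkN (V : normedModType R) k (f : R * R -> V) :
  Ck k U f -> Ck k U (fun p => - f p).
Proof.
elim: k f => [|k IH] f /=.
  by move=> cf p Up; apply: continuousN; exact: cf.
move=> [df f1 f2]; split.
- by move=> p Up; apply: differentiableN; exact: df.
- by apply: Ck_congr (IH _ f1) => p Up; rewrite deriveN //; exact/diff_derivable/df.
- by apply: Ck_congr (IH _ f2) => p Up; rewrite deriveN //; exact/diff_derivable/df.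
Qed.

(** Each term of the product rule has one undifferentiated factor, which [CkS] lowers to the order
    of the induction hypothesis. *)
Lemma CkZ n k (a : R * R -> R) (F : R * R -> 'rV[R]_n) :
  Ck k U a -> Ck k U F -> Ck k U (fun p => a p *: F p).
Proof.
elim: k a F => [|k IH] a F.
  by move=> ca cF p Up; apply: continuousZ; [exact: ca|exact: cF].
move=> ha hF; have [da a1 a2] := ha; have [dF F1 F2] := hF; split.
- by move=> p Up; apply: differentiable_scale; [exact: da|exact: dF].
- apply: Ck_congr (CkD (IH _ _ (CkS ha) F1) (IH _ _ a1 (CkS hF))) => p Up.
  by rewrite (@derive_val _ _ _ _ _ _ _ (is_derive_scale
    (derivableP (diff_derivable (da p Up)))
    (derivableP (diff_derivable (dF p Up))))).
apply: Ck_congr (CkD (IH _ _ (CkS ha) F2) (IH _ _ a2 (CkS hF))) => p Up.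
by rewrite (@derive_val _ _ _ _ _ _ _ (is_derive_scale
  (derivableP (diff_derivable (da p Up)))
  (derivableP (diff_derivable (dF p Up))))).
Qed.

End Ck.

(** * Complex derivatives as real derivatives *)

Section ComplexPlane.
Variable R : realType.
Local Notation C := (R[i]^o).

Definition plane (z : R[i]) : R * R := (complex.Re z, complex.Im z).

Lemma plane_cplx p : plane (cplx p) = p. Proof. by case: p. Qed.
Lemma cplx_plane z : cplx (plane z) = z. Proof. by case: z. Qed.

Lemma cplxD (p q : R * R) : cplx (p + q) = cplx p + cplx q.
Proof. by case: p; case: q. Qed.

Lemma cplxB (p q : R * R) : cplx (p - q) = cplx p - cplx q.
Proof. by case: p; case: q. Qed.

Lemma cplxZ (r : R) (p : R * R) : cplx (r *: p) = r%:C * cplx p.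
Proof.
case: p => a b; rewrite /cplx /=; apply/eqP; rewrite eq_complex /=.
by rewrite !mul0r subr0 addr0 !eqxx.
Qed.

(** The norm of [R[i]] takes its values in [R[i]]; this is the same number in [R], comparable with
    norms in the plane. *)
Definition modulus (z : R[i]) : R :=
  Num.sqrt (complex.Re z ^+ 2 + complex.Im z ^+ 2).

Lemma norm_modulus (z : R[i]) : `|z| = (modulus z)%:C.
Proof. by rewrite normc_def. Qed.

Lemma modulusM (x y : R[i]) : modulus (x * y) = modulus x * modulus y.
Proof. by apply: complexI; rewrite rmorphM /= -!norm_modulus normrM. Qed.

Lemma modulus_real (r : R) : modulus r%:C = `|r|.
Proof. by rewrite /modulus /= expr0n addr0 sqrtr_sqr. Qed.

Lemma plane_norm (z : R[i]) : `|plane z| <= modulus z.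
Proof.
case: z => a b; rewrite /plane /modulus /= [leLHS]/Num.norm /= ge_max.
by rewrite -!sqrtr_sqr !ler_sqrt ?addr_ge0 ?sqr_ge0 // lerDl lerDr !sqr_ge0.
Qed.

(** The plane carries the maximum norm, so the factor [sqrt 2] would be sharp; 2 avoids the root. *)
Lemma cplx_norm (p : R * R) : modulus (cplx p) <= 2 * `|p|.
Proof.
have le1 : `|p.1| <= `|p| by rewrite [leRHS]/Num.norm /= le_max lexx.
have le2 : `|p.2| <= `|p| by rewrite [leRHS]/Num.norm /= le_max lexx orbT.
rewrite -[leRHS]ger0_norm ?mulr_ge0 // -sqrtr_sqr ler_sqrt ?sqr_ge0 //=.
have h1 : p.1 ^+ 2 <= `|p| ^+ 2 by rewrite -real_normK ?num_real // lerXn2r ?nnegrE.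
have h2 : p.2 ^+ 2 <= `|p| ^+ 2 by rewrite -real_normK ?num_real // lerXn2r ?nnegrE.
have := sqr_ge0 `|p|; lra.
Qed.

(** Balls of [R[i]] have radii in [R[i]]; a positive element there is real. *)
Lemma nbhs_complexP (z : C) (A : set C) :
  nbhs z A <-> exists2 d : R, 0 < d & forall y : C, modulus (y - z) < d -> A y.
Proof.
split.
  move=> /nbhs_ballP[e /= e0 H].
  have eE : e = (complex.Re e)%:C by rewrite RRe_real // gtr0_real.
  exists (complex.Re e); first by rewrite -ltcR -eE.
  move=> y yd; apply: H; rewrite -ball_normE /ball_ /= distrC norm_modulus eE.
  by rewrite ltcR.
move=> [d d0 H]; apply/nbhs_ballP; exists d%:C; first by rewrite /= ltcR.
by move=> y; rewrite -ball_normE /ball_ /= distrC norm_modulus ltcR; exact: H.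
Qed.

Lemma cplx_continuous : continuous (@cplx R).
Proof.
move=> p A /nbhs_complexP[d d0 H].
apply/nbhs_ballP; exists (d / 2); first by rewrite /= divr_gt0.
move=> q; rewrite -ball_normE /ball_ /= => pq; apply: H; rewrite -cplxB.
by apply: (le_lt_trans (cplx_norm _)); rewrite mulrC -ltr_pdivlMr // distrC.
Qed.

(** The limit of difference quotients multiplied through by [k]; at [k = 0], which the limit skips,
    both sides vanish. *)
Lemma derivable_complexP (f : C -> C) (z : C) : derivable f z 1 ->
  forall e : R, 0 < e -> exists2 d : R, 0 < d & forall k : C, modulus k < d ->
    modulus (f (k + z) - f z - 'D_1 f z * k) <= e * modulus k.
Proof.
move=> df e e0; pose B : set C := [set y : C | modulus (y - 'D_1 f z) < e].
have : nbhs ('D_1 f z) B by apply/nbhs_complexP; exists e.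
move=> /df /nbhs_complexP[d d0 H]; exists d => // k kd.
have [->|k0] := eqVneq k 0.
  by rewrite add0r subrr mulr0 subrr /modulus /= expr0n /= addr0 sqrtr0 mulr0.
have := H k; rewrite subr0 => /(_ kd k0); rewrite /B /=.
rewrite [_%:A]mulr1.
set y := f _ - f z => /ltW By.
have -> : y - 'D_1 f z * k = (k^-1 * y - 'D_1 f z) * k.
  by rewrite mulrBl mulrAC mulVf ?mul1r.
by rewrite modulusM ler_wpM2r // sqrtr_ge0.
Qed.

(** A real increment [h *: e] is the complex increment [h%:C * cplx e], so the real derivative is
    multiplication by the complex one. Both the change of charts and the Cauchy-Riemann equations
    come from this. *)
Lemma is_derive_cplx (f : C -> C) (p e : R * R) : derivable f (cplx p) 1 ->
  is_derive p e (fun q => plane (f (cplx q)))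
    (plane ('D_1 f (cplx p) * cplx e)).
Proof.
move=> df; set L := 'D_1 f _; set g := fun q => _.
suff H : h^-1 *: ((g \o shift p) (h *: e) - g p) @[h --> (0:R)^']
    --> plane (L * cplx e).
  by apply: DeriveDef; [apply/cvg_ex; eexists; exact: H|exact: cvg_lim].
apply/cvgrPdist_le => eps eps0.
pose n := modulus (cplx e) + 1.
have n0 : 0 < n by rewrite /n ltr_wpDl // sqrtr_ge0.
have en : 0 < eps / n by rewrite divr_gt0.
have [d d0 Hd] := derivable_complexP df en.
near=> h.
have h0 : h != 0 by near: h; exact: nbhs_dnbhs_neq.
have hn : `|h| * n < d.
  rewrite -ltr_pdivlMr //; near: h; apply: dnbhs0_lt.
  by rewrite divr_gt0.
have k1 : modulus (h%:C * cplx e) < d.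
  rewrite modulusM modulus_real; apply: le_lt_trans hn.
  by rewrite ler_wpM2l // /n lerDl.
have := Hd _ k1; rewrite -/L -cplxZ -cplxD.
set y := f _ - f _ => H.
rewrite (_ : plane _ - _ = plane (- (h^-1)%:C * (y - L * cplx (h *: e)))).
  apply: (le_trans (plane_norm _)); rewrite modulusM -rmorphN modulus_real normrN.
  rewrite normfV mulrC ler_pdivrMr ?normr_gt0 //.
  apply: (le_trans H); rewrite cplxZ modulusM modulus_real mulrCA mulrC.
  rewrite ler_wpM2r // -mulrA -[leRHS]mulr1 ler_pM2l // mulrC ler_pdivrMr // mul1r.
  by rewrite /n lerDl.
apply: (can_inj plane_cplx).
rewrite cplxB cplxZ cplxB /g /= !cplx_plane cplxZ -/y.
have hh : (h^-1)%:C * h%:C = 1 :> R[i] by rewrite -rmorphM /= mulVf.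
have alg (A B G K Y : R[i]) : G * K = 1 ->
    A * B - G * Y = - G * (Y - A * (K * B)).
  by move=> GK; rewrite -[A * B]mul1r -GK; ring.
exact: alg.
Unshelve. all: by end_near. Qed.

End ComplexPlane.

(** * Charts and ruled fourfolds *)

Section Charts.
Variables (R : realType) (S : riemann_surface R).
Implicit Types (c : chart R S) (x : S).

Definition pull (V : Type) c (f : S -> V) (p : R * R) : V := f (cinv c (cplx p)).
Definition dplane c : set (R * R) := [set p | ccod c (cplx p)].

Lemma dplane_open c : open (dplane c).
Proof.
have /continuousP := @cplx_continuous R; apply; exact: ccod_open.
Qed.

Lemma dplane_plane c x : cdom c x -> dplane c (plane (cmap c x)).
Proof. by move=> cx; rewrite /dplane /= cplx_plane; exact: cmap_cod. Qed.

Lemma pull_plane (V : Type) c (f : S -> V) x : cdom c x ->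
  pull c f (plane (cmap c x)) = f x.
Proof. by move=> cx; rewrite /pull cplx_plane cmapK. Qed.

Lemma cdom_pull c p : dplane c p -> cdom c (cinv c (cplx p)).
Proof. exact: cinv_dom. Qed.

Lemma dchart_cinv (V : normedModType R) e c (f : S -> V) p : dplane c p ->
  dchart e c f (cinv c (cplx p)) = 'D_e (pull c f) p.
Proof. by move=> Up; rewrite /dchart cinvK // -/(plane _) plane_cplx. Qed.

Lemma near_dplane c p : dplane c p -> \forall q \near p, dplane c q.
Proof. by move=> Up; apply: open_nbhs_nbhs; split => //; exact: dplane_open. Qed.

Lemma smooth_differentiable (V : normedModType R) c (f : S -> V) p :
  atlas c -> smooth f -> dplane c p -> differentiable (pull c f) p.
Proof. by move=> ac sf Up; have [+ _ _] := sf c ac 1%N; exact. Qed.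

Lemma diff_plane (V : normedModType R) (f : R * R -> V) p a b :
  differentiable f p ->
  'd f p (a, b) = a *: 'D_((1, 0) : R * R) f p + b *: 'D_((0, 1) : R * R) f p.
Proof.
move=> df; rewrite !deriveE // -!linearZ -linearD /=; congr ('d f p _).
by congr (_, _); rewrite /= /GRing.scale /= !(mulr1, mulr0) ?addr0 ?add0r.
Qed.

(** Near [x], [f] read in [c'] is [f] read in [c] after the transition map, whose real derivative is
    multiplication by [L]. *)
Lemma dchart_change (V : normedModType R) e c c' (f : S -> V) x
    (L := 'D_1 (transition c' c) (cmap c' x)) :
  atlas c -> atlas c' -> cdom c x -> cdom c' x -> smooth f ->
  dchart e c' f x =
  complex.Re (L * cplx e) *: ds c f x + complex.Im (L * cplx e) *: dt c f x.
Proof.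
move=> ac ac' cx cx' sf; rewrite /dchart -/(plane _); set p := plane _.
have Up : dplane c' p by exact: dplane_plane.
pose g q := plane (transition c' c (cplx q)).
have gp : g p = plane (cmap c x).
  by rewrite /g /p cplx_plane /transition cmapK.
have ov : overlap c' c (cplx p).
  by split => //; rewrite /p cplx_plane cmapK.
have E : \forall q \near p, f (cinv c' (cplx q)) = (pull c f \o g) q.
  have H : \forall q \near p, cdom c (cinv c' (cplx q)).
    have cc : {for p, continuous (cinv c' \o @cplx R)}.
      apply: continuous_comp; first exact: cplx_continuous.
      exact: cinv_continuous.
    apply: cc; apply: open_nbhs_nbhs; split; first exact: cdom_open.
    by case: ov.
  apply: filterS H => q cq.
  by rewrite /= /pull /g cplx_plane /transition cmapK.
rewrite (near_eq_derive _ E).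
have tau : derivable (transition c' c) (cplx p) 1.
  by have [+ _] := atlas_compatible ac' ac; exact.
have dF : differentiable (pull c f) (g p).
  by rewrite gp; apply: smooth_differentiable => //; exact: dplane_plane.
have := is_derive_comp (is_derive_cplx e tau) dF => -[_ ->].
rewrite -/(g p) /plane diff_plane // gp.
by rewrite /p cplx_plane -/L.
Qed.

(** The coordinate derivatives and the components of [w] transform by the same complex factor, so
    the chart chosen in [lie] can be replaced by [c]. *)
Lemma lieE (V : normedModType R) (w : vfield S) (f : S -> V) c x :
  vfield_law w -> smooth f -> atlas c -> cdom c x ->
  lie w f x = complex.Re (w c x) *: ds c f x + complex.Im (w c x) *: dt c f x.
Proof.
move=> wl sf ac cx; rewrite /lie; set c' := chart_at x.
have ac' : atlas c' by rewrite /c' /chart_at; case: cid2.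
have cx' : cdom c' x by rewrite /c' /chart_at; case: cid2.
rewrite {1}/ds {1}/dt !(@dchart_change _ _ c c') // (wl c' c) //.
move: (derive (transition c' c) _ _) (w c' x) (ds c f x) (dt c f x)
  => [l1 l2] [w1 w2] A B.
rewrite /cplx /= !scalerDr !scalerA addrACA -!scalerDl.
by congr (_ *: _ + _ *: _); ring.
Qed.

Lemma ivfield_law (w : vfield S) : vfield_law w -> vfield_law (ivfield w).
Proof.
by move=> wl c c' x ac ac' cx cx'; rewrite /ivfield (wl c c') // mulrCA.
Qed.

(** The derivative of [(u, v)] is multiplication by one complex number; its values in the directions
    1 and i are compared. *)
Lemma cauchy_riemann (w : vfield S) c p (u := pull c (fun x => complex.Re (w c x)))
    (v := pull c (fun x => complex.Im (w c x))) :
  holomorphic_vfield w -> atlas c -> dplane c p ->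
  'D_((1, 0) : R * R) u p = 'D_((0, 1) : R * R) v p /\
  'D_((0, 1) : R * R) u p = - 'D_((1, 0) : R * R) v p.
Proof.
move=> [_ ws wh] ac Up; have [us vs] := ws c ac.
have du e : derivable u p e.
  by have [+ _ _] := us 1%N; move=> /(_ p Up) h; exact: diff_derivable.
have dv e : derivable v p e.
  by have [+ _ _] := vs 1%N; move=> /(_ p Up) h; exact: diff_derivable.
have := wh c ac _ Up; set f := fun z => w c (cinv c z) => df.
have D e : ('D_e u p, 'D_e v p) = plane ('D_1 f (cplx p) * cplx e).
  have [_ <-] := is_derive_cplx e df.
  by have [_ <-] := is_derive_pair (derivableP (du e)) (derivableP (dv e)).
have := D (1, 0); have := D (0, 1); case: (derive f _ _) => l1 l2.
rewrite /plane /cplx /= => -[-> ->] [-> ->]; split; ring.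
Qed.

(** [derive_sym] concerns scalar functions, so it is applied to each coordinate. *)
Lemma pull_derive_sym n c (f : S -> 'rV[R]_n) p
    (v := (1, 0) : R * R) (w := (0, 1) : R * R) :
  atlas c -> smooth f -> dplane c p ->
  'D_w (fun q => 'D_v (pull c f) q) p = 'D_v (fun q => 'D_w (pull c f) q) p.
Proof.
move=> ac sf Up; set P := pull c f.
have [dP dPs dPt] := sf c ac 2%N; rewrite -/(pull c f) -/P -/v -/w in dPs dPt.
move: v w dPs dPt => v w dPs dPt.
have dPd q e : dplane c q -> derivable P q e.
  by move=> Uq; exact/diff_derivable/dP.
have dPv : differentiable (fun q => 'D_v P q) p by case: dPs => + _ _; exact.
have dPw : differentiable (fun q => 'D_w P q) p by case: dPt => + _ _; exact.
pose cf j (F : R * R -> 'rV[R]_n) q := F q 0 j.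
have dcf F j q : differentiable F q -> differentiable (cf j F) q.
  move=> dF.
  apply: (@differentiable_comp _ _ _ _ F (fun M : 'rV[R]_n => M 0 j)) => //.
  exact: differentiable_coord.
have cfD e j (F : R * R -> 'rV[R]_n) q : derivable F q e ->
    ('D_e F q : 'rV[R]_n) 0 j = 'D_e (cf j F) q.
  by move=> dF; rewrite derive_mx // mxE.
have nE e j : \forall q \near p, cf j (fun q => 'D_e P q) q = 'D_e (cf j P) q.
  by apply: filterS (near_dplane Up) => q Uq; apply: cfD; exact: dPd.
apply/rowP => j.
have E1 := cfD w j (fun q => 'D_v P q) p (diff_derivable dPv).
have E2 := cfD v j (fun q => 'D_w P q) p (diff_derivable dPw).
apply: (etrans E1); apply: (etrans _ (esym E2)).
have N1 := near_eq_derive w (nE v j); have N2 := near_eq_derive v (nE w j).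
apply: (etrans N1); apply: (etrans _ (esym N2)).
apply: derive_sym.
- by apply: filterS (near_dplane Up) => q Uq; exact/dcf/dP.
- by apply: near_eq_differentiable (nE v j) _; exact: dcf.
- by apply: near_eq_differentiable (nE w j) _; exact: dcf.
Qed.

End Charts.

(** * The map [psi] of a holomorphic vector field *)

Section RuledFourfold.
Variables (R : realType) (S : riemann_surface R).
Variables (phi1 phi2 : S -> 'rV[R]_7) (w : vfield S).
Hypothesis sphi1 : smooth phi1.
Hypothesis sphi2 : smooth phi2.
Hypothesis on : Defs.orthonormal phi1 phi2.
Hypothesis gauge : adapted_flat_gauge phi1 phi2.
Hypothesis holw : holomorphic_vfield w.

Local Notation es := ((1, 0) : R * R).
Local Notation et := ((0, 1) : R * R).

Let psi x := lie w phi1 x + lie (ivfield w) phi2 x.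

Section InChart.
Variable c : chart R S.
Hypothesis ac : atlas c.

Let P1 := pull c phi1.
Let P2 := pull c phi2.
Let u := pull c (fun x => complex.Re (w c x)).
Let v := pull c (fun x => complex.Im (w c x)).

(** The expression of [psi] in the coordinate [c]; the signs of the second line come from iw having
    components [- v] and [u]. *)
Let psi_loc (p : R * R) : 'rV[R]_7 :=
  u p *: 'D_es P1 p + v p *: 'D_et P1 p
  + (- v p *: 'D_es P2 p + u p *: 'D_et P2 p).

Lemma pull_psi p : dplane c p -> pull c psi p = psi_loc p.
Proof.
have [wl _ _] := holw.
move=> Up; have cx := cdom_pull Up; rewrite /pull /psi (lieE wl sphi1 ac cx).
rewrite (lieE (ivfield_law wl) sphi2 ac cx) /ds /dt !dchart_cinv //.
rewrite /psi_loc /u /v /pull /ivfield.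
by case: (w _ _) => a b; rewrite /= !(mul0r, mul1r, sub0r, add0r).
Qed.

Lemma smooth_pull_psi k : Ck k (dplane c) (pull c psi).
Proof.
have [_ ws _] := holw; have [su sv] := ws c ac.
(* As [psi] contains first derivatives of [phi1] and [phi2], order [k] for [psi] uses order [k.+1]
   for them. *)
have s1 : Ck k (dplane c) (fun p => 'D_es P1 p) by case: (sphi1 ac k.+1).
have t1 : Ck k (dplane c) (fun p => 'D_et P1 p) by case: (sphi1 ac k.+1).
have s2 : Ck k (dplane c) (fun p => 'D_es P2 p) by case: (sphi2 ac k.+1).
have t2 : Ck k (dplane c) (fun p => 'D_et P2 p) by case: (sphi2 ac k.+1).
have oU := @dplane_open _ _ c.
apply: (@Ck_congr _ _ oU _ _ psi_loc) => [p Up|]; first by rewrite pull_psi.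
have hu : Ck k (dplane c) u := su k.
have hv : Ck k (dplane c) v := sv k.
have H := CkD oU (CkD oU (CkZ oU hu s1) (CkZ oU hv t1))
  (CkD oU (CkZ oU (CkN oU hv) s2) (CkZ oU hu t2)).
exact: H.
Qed.

Lemma pull_gauge p phi : dplane c p -> phi = phi1 \/ phi = phi2 ->
  'D_et (pull c phi) p = triple_cross (P1 p) (P2 p) ('D_es (pull c phi) p) /\
  'D_es (pull c phi) p = - triple_cross (P1 p) (P2 p) ('D_et (pull c phi) p).
Proof.
move=> Up phiE; have := gauge ac (cdom_pull Up) phiE.
by rewrite /ds /dt !dchart_cinv.
Qed.

(** The gauge equations hold on the whole chart, hence near [p], and can be differentiated by the
    product rule. *)
Lemma derive_gauge p phi e : dplane c p -> phi = phi1 \/ phi = phi2 ->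
  'D_e (fun q => 'D_et (pull c phi) q) p =
    triple_cross ('D_e P1 p) (P2 p) ('D_es (pull c phi) p)
    + triple_cross (P1 p) ('D_e P2 p) ('D_es (pull c phi) p)
    + triple_cross (P1 p) (P2 p) ('D_e (fun q => 'D_es (pull c phi) q) p) /\
  'D_e (fun q => 'D_es (pull c phi) q) p =
    - (triple_cross ('D_e P1 p) (P2 p) ('D_et (pull c phi) p)
    + triple_cross (P1 p) ('D_e P2 p) ('D_et (pull c phi) p)
    + triple_cross (P1 p) (P2 p) ('D_e (fun q => 'D_et (pull c phi) q) p)).
Proof.
move=> Up phiE; have sphi : smooth phi by case: phiE => ->.
have [_ [ds _ _] [dt _ _]] := sphi c ac 2%N.
have h1 : is_derive p e P1 ('D_e P1 p).
  by apply/derivableP/diff_derivable; exact: smooth_differentiable.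
have h2 : is_derive p e P2 ('D_e P2 p).
  by apply/derivableP/diff_derivable; exact: smooth_differentiable.
have hs := derivableP (diff_derivable (v := e) (ds p Up)).
have ht := derivableP (diff_derivable (v := e) (dt p Up)).
have Es : \forall q \near p, 'D_et (pull c phi) q =
    triple_cross (P1 q) (P2 q) ('D_es (pull c phi) q).
  apply: filterS (near_dplane Up) => q Uq.
  by have [] := pull_gauge Uq phiE.
have Et : \forall q \near p, 'D_es (pull c phi) q =
    - triple_cross (P1 q) (P2 q) ('D_et (pull c phi) q).
  apply: filterS (near_dplane Up) => q Uq.
  by have [] := pull_gauge Uq phiE.
have [_ Ds] := is_derive_triple_cross h1 h2 hs.
have [_ Dt] := is_deriveN (is_derive_triple_cross h1 h2 ht).
split; first exact: etrans (near_eq_derive e Es) Ds.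
exact: etrans (near_eq_derive e Et) Dt.
Qed.

Lemma derive_psi_loc p e : dplane c p -> 'D_e (pull c psi) p =
  u p *: 'D_e (fun q => 'D_es P1 q) p + 'D_e u p *: 'D_es P1 p
  + (v p *: 'D_e (fun q => 'D_et P1 q) p + 'D_e v p *: 'D_et P1 p)
  + (- v p *: 'D_e (fun q => 'D_es P2 q) p + - 'D_e v p *: 'D_es P2 p
     + (u p *: 'D_e (fun q => 'D_et P2 q) p + 'D_e u p *: 'D_et P2 p)).
Proof.
move=> Up; have [_ ws _] := holw; have [su sv] := ws c ac.
have [_ [ds1 _ _] [dt1 _ _]] := sphi1 ac 2%N.
have [_ [ds2 _ _] [dt2 _ _]] := sphi2 ac 2%N.
have [du _ _] := su 1%N; have [dv _ _] := sv 1%N.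
have hu := derivableP (diff_derivable (v := e) (du p Up)).
have hv := derivableP (diff_derivable (v := e) (dv p Up)).
have hs1 := derivableP (diff_derivable (v := e) (ds1 p Up)).
have ht1 := derivableP (diff_derivable (v := e) (dt1 p Up)).
have hs2 := derivableP (diff_derivable (v := e) (ds2 p Up)).
have ht2 := derivableP (diff_derivable (v := e) (dt2 p Up)).
have E : \forall q \near p, pull c psi q = psi_loc q.
  by apply: filterS (near_dplane Up) => q; exact: pull_psi.
have H := is_deriveD
  (is_deriveD (is_derive_scale hu hs1) (is_derive_scale hv ht1))
  (is_deriveD (is_derive_scale (is_deriveN hv) hs2) (is_derive_scale hu ht2)).
have [_ H'] := H.
exact: etrans (near_eq_derive e E) H'.
Qed.

(** Feeds [ruling_span2] with its analytic data: the gauge equations and their derivatives along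
    [es] and [et], the symmetry of second derivatives, and the Cauchy-Riemann equations. *)
Lemma psi_span p : dplane c p ->
  let J := triple_cross (P1 p) (P2 p) in
  in_span (P1 p) (P2 p) ('D_et (pull c psi) p - J ('D_es (pull c psi) p)) /\
  in_span (P1 p) (P2 p) ('D_es (pull c psi) p + J ('D_et (pull c psi) p)).
Proof.
move=> Up J.
have on2 : orthonormal2 (P1 p) (P2 p) by have [? ? ?] := on (cinv c (cplx p)).
have i1 : phi1 = phi1 \/ phi1 = phi2 by left.
have i2 : phi2 = phi1 \/ phi2 = phi2 by right.
have [CR1 CR2] := cauchy_riemann holw ac Up.
have [g1t g1s] := pull_gauge Up i1; have [g2t g2s] := pull_gauge Up i2.
have [d1st d1ss] := derive_gauge es Up i1.
have [d1tt d1ts] := derive_gauge et Up i1.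
have [d2st d2ss] := derive_gauge es Up i2.
have [d2tt d2ts] := derive_gauge et Up i2.
have sym1 := pull_derive_sym ac sphi1 Up.
have sym2 := pull_derive_sym ac sphi2 Up.
have psiS := derive_psi_loc es Up; have psiT := derive_psi_loc et Up.
exact: (ruling_span2 on2 g1t g1s g2t g2s d1st d1ss d1tt d1ts d2st d2ss d2tt d2ts
  sym1 sym2 CR1 CR2 psiS psiT).
Qed.

End InChart.

Lemma smooth_psi : smooth psi.
Proof. by move=> c ac k; exact: smooth_pull_psi. Qed.

Lemma psi_span_chart c x : atlas c -> cdom c x ->
  let J := triple_cross (phi1 x) (phi2 x) in
  in_span (phi1 x) (phi2 x) (dt c psi x - J (ds c psi x)) /\
  in_span (phi1 x) (phi2 x) (ds c psi x + J (dt c psi x)).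
Proof.
move=> ac cx; have := psi_span ac (dplane_plane cx).
by rewrite !pull_plane.
Qed.

End RuledFourfold.

(** * Tangent frames of the ruled map *)

Section Frames.
Variables (R : realType) (S : riemann_surface R).
Implicit Types (c : chart R S) (x : S) (f g : S -> 'rV[R]_7).

Lemma is_derive_affine (A B C : 'rV[R]_7) (r e : R * R) :
  is_derive r e (fun r : R * R => r.1 *: A + r.2 *: B + C) (e.1 *: A + e.2 *: B).
Proof.
pose l (r : R * R) : 'rV[R]_7 := r.1 *: A + r.2 *: B.
have Q : (fun h : R => h^-1 *: (((fun r => l r + C) \o shift r) (h *: e)
    - (l r + C))) @ 0^' --> l e.
  apply/cvgrPdist_le => eps eps0; near=> h.
  have h0 : h != 0 by near: h; exact: nbhs_dnbhs_neq.
  (* For an affine map the difference quotient equals its limit at every nonzero [h]. *)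
  rewrite (_ : l e - _ = 0) ?normr0 ?ltW //.
  rewrite /l /=; apply/rowP => j; rewrite !row_linE /=.
  by rewrite /GRing.scale /=; field.
change (is_derive r e (fun r => l r + C) (l e)).
by apply: DeriveDef; [apply/cvg_ex; exists (l e); exact: Q|exact: cvg_lim].
Unshelve. all: by end_near. Qed.

Lemma dchart_affine e c f1 f2 g (a b : R) x :
  atlas c -> cdom c x -> smooth f1 -> smooth f2 -> smooth g ->
  dchart e c (fun y => a *: f1 y + b *: f2 y + g y) x =
  a *: dchart e c f1 x + b *: dchart e c f2 x + dchart e c g x.
Proof.
move=> ac cx s1 s2 s3; have Up := dplane_plane cx.
have d f : smooth f -> is_derive (plane (cmap c x)) e (pull c f) (dchart e c f x).
  move=> sf; apply/derivableP/diff_derivable; exact: smooth_differentiable.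
have [_ H] := is_deriveD (is_deriveD (is_deriveZ a (d f1 s1))
  (is_deriveZ b (d f2 s2))) (d g s3).
exact: H.
Qed.

(** The image of the coordinate vector [e] of the surface under the differential of [iota2 f1 f2 g],
    written so that its affine dependence on [q.1] is visible. *)
Definition velocity (e : R * R) c f1 f2 g (q : (R * R) * S) : 'rV[R]_7 :=
  q.1.1 *: dchart e c f1 q.2 + q.1.2 *: dchart e c f2 q.2 + dchart e c g q.2.

Lemma frame_iota2 c f1 f2 g q :
  atlas c -> cdom c q.2 -> smooth f1 -> smooth f2 -> smooth g ->
  frame c (iota2 f1 f2 g) q =
  rows4 (f1 q.2) (f2 q.2)
    (velocity (1, 0) c f1 f2 g q) (velocity (0, 1) c f1 f2 g q).
Proof.
move=> ac cq s1 s2 s3; rewrite /frame.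
have H1 : 'D_((1, 0) : R * R) (fun r => iota2 f1 f2 g (r, q.2)) q.1 = f1 q.2.
  have [_ ->] := is_derive_affine (f1 q.2) (f2 q.2) (g q.2) q.1 (1, 0).
  by rewrite /= scale1r scale0r addr0.
have H2 : 'D_((0, 1) : R * R) (fun r => iota2 f1 f2 g (r, q.2)) q.1 = f2 q.2.
  have [_ ->] := is_derive_affine (f1 q.2) (f2 q.2) (g q.2) q.1 (0, 1).
  by rewrite /= scale1r scale0r add0r.
by congr rows4 => //; exact: dchart_affine.
Qed.

Lemma velocity_change c c' f1 f2 g q :
  atlas c -> atlas c' -> cdom c q.2 -> cdom c' q.2 ->
  smooth f1 -> smooth f2 -> smooth g -> exists al be : R,
  velocity (1, 0) c f1 f2 g q =
    al *: velocity (1, 0) c' f1 f2 g q + be *: velocity (0, 1) c' f1 f2 g q.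
Proof.
move=> ac ac' cq cq' s1 s2 s3.
set L := derive (transition c c') (cmap c q.2) 1.
(* The components in [c'] of the first coordinate vector of [c]. *)
exists (complex.Re (L * cplx (1, 0))), (complex.Im (L * cplx (1, 0))).
rewrite {1}/velocity !(dchart_change _ ac' ac cq' cq) // -/L.
have alg (k1 k2 r1 r2 : R) (A1 A2 A3 B1 B2 B3 : 'rV[R]_7) :
    r1 *: (k1 *: A1 + k2 *: B1) + r2 *: (k1 *: A2 + k2 *: B2)
      + (k1 *: A3 + k2 *: B3) =
    k1 *: (r1 *: A1 + r2 *: A2 + A3) + k2 *: (r1 *: B1 + r2 *: B2 + B3).
  by vring.
exact: alg.
Qed.
End Frames.

Theorem theorem4p12 (R : realType) (Sigma : riemann_surface R)
    (phi1 phi2 : Sigma -> 'rV[R]_7) (M0 : set 'rV[R]_7) (w : vfield Sigma)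
    (psi : Sigma -> 'rV[R]_7) (M : set 'rV[R]_7) :
  rframed_2ruled_coassociative_cone M0 phi1 phi2 ->
  adapted_flat_gauge phi1 phi2 ->
  holomorphic_vfield w ->
  psi = (fun x => lie w phi1 x + lie (ivfield w) phi2 x) ->
  M = [set y | exists r1 r2 x, y = r1 *: phi1 x + r2 *: phi2 x + psi x] ->
  rframed_2ruled_coassociative M phi1 phi2 psi.
Proof.
move=> [[[[s1 s2 s0] on _ _] _] cone] gauge holw psiE ->.
have s3 : smooth psi by rewrite psiE; exact: smooth_psi.
have on2 x : orthonormal2 (phi1 x) (phi2 x) by have [? ? ?] := on x.
pose J x := triple_cross (phi1 x) (phi2 x).
have J0 x : J x 0 = 0.
  by rewrite -(scale0r (0 : 'rV[R]_7)) /J triple_crossZ !scale0r.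
have spans c q : atlas c -> cdom c q.2 ->
    let X := velocity (1, 0) c phi1 phi2 psi q in
    let Y := velocity (0, 1) c phi1 phi2 psi q in
    in_span (phi1 q.2) (phi2 q.2) (Y - J q.2 X) /\
    in_span (phi1 q.2) (phi2 q.2) (X + J q.2 Y).
  move=> ac cq X Y.
  have [h1 h2] := gauge _ _ ac cq _ (or_introl erefl).
  have [h3 h4] := gauge _ _ ac cq _ (or_intror erefl).
  have [k1 k2] := psi_span_chart s1 s2 on gauge holw ac cq.
  rewrite -psiE in k1 k2.
  exact: (in_span_affine q.1.1 q.1.2 h1 h2 h3 h4 k1 k2).
(* Immersion is asked in every chart; if [J] killed the velocity in another chart, it would kill the
   one in [c] as well. *)
have immersed c q : atlas c -> cdom c q.2 ->
    J q.2 (velocity (1, 0) c phi1 phi2 psi q) <> 0 ->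
    immersion_at (iota2 phi1 phi2 psi) q.
  move=> ac cq JX c' ac' cq'; rewrite frame_iota2 //.
  have [k1 k2] := spans c' q ac' cq'.
  apply: (rank_frame (on2 q.2) k1 k2) => JX'; apply: JX.
  have [al [be XE]] := velocity_change ac ac' cq cq' s1 s2 s3.
  by rewrite XE; exact: triple_cross_frame_eq0 k1 JX'.
split; last first.
  (* The frames are positively calibrated as they stand, so the orientation sign is constantly
     +1. *)
  exists (fun=> false); split; first by move=> q _; apply: filterE.
  move=> q c _ ac cq C E; have [k1 k2] := spans c q ac cq.
  rewrite /E frame_iota2 // [(-1) ^+ _]expr0 mul1r.
  exact: (calibrated_frame (on2 q.2) k1 k2).
split => //.
  apply/seteqP; split => [y [r1 [r2 [x ->]]]|y [[[r1 r2] x] _ <-]].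
    by exists ((r1, r2), x).
  by exists r1, r2, x.
move=> O [[r0 x0] Oq] oO.
have [c ac cx] := atlas_cover x0.
(* If the chosen point of [O] fails the criterion, it is moved inside its fibre along [r1]. *)
have [JX|JX] := pselect
  (J x0 (velocity (1, 0) c phi1 phi2 psi (r0, x0)) = 0); last first.
  by exists (r0, x0); split => //; exact: (immersed c).
(* Otherwise the gauge equations give [ds c phi1 x0 = 0]. This is the velocity of the cone at
   [r = (1, 0)], where the cone is immersed. *)
have Ja : J x0 (ds c phi1 x0) <> 0.
  move=> Ja0; have q0 : ((1 : R), (0 : R)) <> (0, 0).
    by move=> [] /eqP; rewrite oner_eq0.
  have := cone ((1, 0), x0) q0 c ac cx; rewrite frame_iota2 //.
  move=> /rank_frame_notin_span; apply; exists 0, 0.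
  have [h1 h2] := gauge _ _ ac cx _ (or_introl erefl).
  rewrite /velocity /= -/(ds c phi1 x0) h2 h1.
  rewrite [triple_cross _ _ (ds _ _ _)]Ja0 [triple_cross _ _ 0]J0.
  rewrite /dchart derive_cst; apply/rowP => j; rewrite !row_linE; ring.
have c1 : h *: ((1, 0) : R * R) + r0 @[h --> (0 : R)] --> r0.
  rewrite -[X in _ --> X]add0r -(scale0r ((1, 0) : R * R)).
  by apply: cvgD; [exact: scalel_continuous|exact: cvg_cst].
have c2 : x0 @[_ --> (0 : R)] --> x0 by exact: cvg_cst.
have nO : \forall h \near (0 : R)^'+, O ((h *: ((1, 0) : R * R) + r0), x0).
  have nq : nbhs (r0, x0) O by apply: open_nbhs_nbhs.
  by apply: cvg_within; exact: (cvg_pair c1 c2 nq).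
have [h [h0 Oh]] := filter_ex (filterI (nbhs_right_gt (0 : R)) nO).
exists ((h *: ((1, 0) : R * R) + r0), x0); split => //.
apply: (immersed c) => //= JX'; apply: Ja.
(* [J X] is affine in [r1] and vanishes at both [r0] and the shifted point; the difference of these
   values is [h] times the slope. *)
have : h *: J x0 (ds c phi1 x0) = 0.
  rewrite -JX' -[LHS]addr0 -[X in _ + X]JX /J -triple_crossZ -triple_crossD.
  congr (triple_cross _ _ _).
  rewrite /velocity /ds /=; apply/rowP => j; rewrite !row_linE.
  by rewrite /GRing.scale /=; ring.
move=> /eqP; rewrite scaler_eq0 => /orP[/eqP hE|/eqP //].
by rewrite hE /= ltxx in h0.
Qed.
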